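(* Let $k$ be a non-archimedean local field with ring of integers $\mathcal O_k$, uniformizing parameter $\pi$, and residue field of cardinality $p$. Let $\mathfrak E\subseteq\mathbb M_2(k)$ be an Eichler order of level $r\ge0$, let $t\ge0$ be an integer, let $\mathfrak H_0=\begin{pmatrix}\mathcal O_k&\mathcal O_k\\0&\mathcal O_k\end{pmatrix}$ be the ring of integral upper triangular matrices, and let $\mathfrak H=\mathfrak H_0^{[t]}=\mathcal O_k\mathfrak 1+\pi^t\mathfrak H_0$. Then $\mathfrak H$ embeds optimally into $\mathfrak E$ if and only if $r\ge 2t$. In this case, if $t>0$, the vector of embedding numbers $\vec e=(e_1,e_2,e_3,e_4)$ of $\mathfrak H$ into $\mathfrak E$ (defined in the context) is $$\vec e=\begin{cases}\left((p-1)p^{2t-1},\ \tfrac12(p-1)p^{2t-1},\ 1,\ 1\right)&\text{if } r=2t,\\[4pt]\left(2(p-1)p^{2t-1},\ (p-1)p^{2t-1},\ 2,\ 1\right)&\text{if } r>2t,\end{cases}$$ while if $t=0$, then $\vec e=(1,1,1,1)$ if $r=0$ and $\vec e=(2,1,2,1)$ if $r>0$.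
   Context: $\mathfrak 1$ denotes the identity matrix. An Eichler order in $\mathbb M_2(k)$ is an intersection $\mathfrak E=\mathfrak D_1\cap\mathfrak D_2$ of two maximal orders; it has level $r\in\mathbb Z_{\ge0}$ if $\mathfrak D_1/\mathfrak E\cong\mathfrak D_2/\mathfrak E\cong\mathcal O_k/\pi^r\mathcal O_k$ as $\mathcal O_k$-modules. For an order $\mathfrak H$ spanning the $k$-algebra $L=k\mathfrak H$, an optimal embedding $\mathfrak H\to\mathfrak E$ is a homomorphism induced by a $k$-algebra embedding $\phi:L\to\mathbb M_2(k)$ with $\phi^{-1}(\mathfrak E)=\mathfrak H$. A suborder $\mathfrak H'\subseteq\mathfrak E$ is optimal if $k\mathfrak H'\cap\mathfrak E=\mathfrak H'$. Let $X$ be the set of optimal embeddings $\mathfrak H\to\mathfrak E$, and let $Y$ be the set of optimal suborders of $\mathfrak E$ isomorphic to $\mathfrak H$. Let $\Gamma_1=k^*\mathfrak E^*$ and let $\Gamma_2=\{g\in\mathrm{GL}_2(k): g\mathfrak E g^{-1}=\mathfrak E\}$; both act by conjugation on $X$ and $Y$. The embedding numbers are $$e_1=|X/\Gamma_1|,\quad e_2=|X/\Gamma_2|,\quad e_3=|Y/\Gamma_1|,\quad e_4=|Y/\Gamma_2|.$$ *)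

(* Defs.v *)
From mathcomp Require Import all_boot all_order all_algebra.
From mathcomp Require Import boolp classical_sets functions cardinality.

Set Implicit Arguments.
Unset Strict Implicit.
Unset Printing Implicit Defensive.

Import Order.TTheory GRing.Theory Num.Theory.
Local Open Scope classical_set_scope.
Local Open Scope ring_scope.
Local Open Scope card_scope.

(* The set of classes X / R, each class being a subset of X. *)
Definition classes_of (T : Type) (X : set T) (R : T -> T -> Prop) :
  set (set T) := [set [set y | X y /\ R x y] | x in X].

Section LocalField.
Variables (k : fieldType) (v : k -> int).

(* v stands for a valuation k -> int with v(0) = +oo: the integer v 0 is
   irrelevant, and 0 belongs to every ideal by fiat. *)
Definition val_ideal (n : int) : set k := [set x | x = 0 \/ n <= v x].

Definition integers : set k := val_ideal 0.

Definition residue_field : set (set k) :=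
  classes_of integers (fun x y => val_ideal 1 (x - y)).

Definition cauchy_seq (u : nat -> k) : Prop :=
  forall N : int, exists M : nat,
    forall m n : nat, (M <= m)%N -> (M <= n)%N -> val_ideal N (u m - u n).

Definition converges_to (u : nat -> k) (l : k) : Prop :=
  forall N : int, exists M : nat,
    forall n : nat, (M <= n)%N -> val_ideal N (u n - l).

Definition uniformizer (pi : k) : Prop := pi <> 0 /\ v pi = 1.

Record local_field : Prop := LocalField {
  valM : forall x y, x <> 0 -> y <> 0 -> v (x * y) = v x + v y;
  valD : forall x y, x <> 0 -> y <> 0 -> x + y <> 0 ->
    Num.min (v x) (v y) <= v (x + y);
  val_normalized : exists pi, uniformizer pi;
  val_complete : forall u, cauchy_seq u -> exists l, converges_to u l;
  residue_finite : finite_set residue_field }.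

End LocalField.

Section Modules.
Variables (k : fieldType).

(* Finite linear combinations of elements of A with coefficients in S. *)
Definition lin_span (V : lmodType k) (S : set k) (A : set V) : set V :=
  [set x | exists (n : nat) (c : 'I_n -> k) (y : 'I_n -> V),
     [/\ forall i, S (c i), forall i, A (y i) & x = \sum_i c i *: y i]].

(* A / B and C / D are isomorphic S-modules, for S a subring of k and
   S-submodules B of A and D of C. An isomorphism is represented by a lift
   f : A -> C, which is S-linear modulo D; its values outside A are
   irrelevant. *)
Definition quotient_iso (V W : lmodType k) (S : set k)
    (A B : set V) (C D : set W) : Prop :=
  exists f : V -> W,
    [/\ forall x, A x -> C (f x),
        forall x y, A x -> A y -> D (f (x + y) - (f x + f y)),
        forall a x, S a -> A x -> D (f (a *: x) - a *: f x),
        forall x, A x -> (D (f x) <-> B x) &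
        forall z, C z -> exists2 x, A x & D (z - f x)].

End Modules.

Section Orders.
Variables (k : fieldType).
Local Notation M2 := 'M[k]_2.

(* f restricts to a unital homomorphism of S-algebras on A; its values outside
   A are irrelevant. *)
Definition alg_morph_on (S : set k) (A : set M2) (f : M2 -> M2) : Prop :=
  [/\ f 1%:M = 1%:M,
      forall x y, A x -> A y -> f (x + y) = f x + f y,
      forall x y, A x -> A y -> f (x *m y) = f x *m f y &
      forall a x, S a -> A x -> f (a *: x) = a *: f x].

Definition kspan (A : set M2) : set M2 := lin_span [set: k] A.

Definition conj_by (g x : M2) : M2 := g *m x *m invmx g.

Variable v : k -> int.
Local Notation O := (integers v).

(* An order of the k-algebra kspan A. *)
Definition is_order (A : set M2) : Prop :=
  [/\ A 1%:M,
      forall x y, A x -> A y -> A (x *m y) &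
      exists s : seq M2, A = lin_span O [set` s]].

Definition maximal_order (D : set M2) : Prop :=
  [/\ is_order D, kspan D = [set: M2] &
      forall D', is_order D' -> D `<=` D' -> D' = D].

Definition pow_ideal (pi : k) (r : nat) : set k^o :=
  [set pi ^+ r * a | a in O].

Definition eichler_order (pi : k) (r : nat) (E : set M2) : Prop :=
  exists D1 D2 : set M2,
    [/\ maximal_order D1, maximal_order D2, E = D1 `&` D2,
        quotient_iso O D1 E (O : set k^o) (pow_ideal pi r) &
        quotient_iso O D2 E (O : set k^o) (pow_ideal pi r)].

Definition upper_order : set M2 :=
  [set x | [/\ O (x 0 0), O (x 0 1), x 1 0 = 0 & O (x 1 1)]].

(* H^[t] = O 1 + pi^t H *)
Definition order_level (pi : k) (t : nat) (H : set M2) : set M2 :=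
  [set a%:M + pi ^+ t *: y | a in O & y in H].

Definition order_iso (A B : set M2) : Prop :=
  exists f : M2 -> M2, alg_morph_on O A f /\ set_bij A B f.

(* Optimal embeddings are genuine functions on the order H, so that the
   extension phi to kspan H, and its values elsewhere, are not counted. *)
Definition optimal_embeddings (E H : set M2) : set (H -> M2) :=
  [set f | exists phi : M2 -> M2,
    [/\ alg_morph_on [set: k] (kspan H) phi,
        set_inj (kspan H) phi,
        kspan H `&` phi @^-1` E = H &
        forall x : H, f x = phi (val x)]].

Arguments optimal_embeddings E H _ : clear implicits.

Definition optimal_suborders (E H : set M2) : set (set M2) :=
  [set H' | [/\ is_order H', H' `<=` E, kspan H' `&` E = H' &
                order_iso H H']].

Definition Gamma1 (E : set M2) : set M2 :=
  [set g | exists (a : k) (u : M2),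
    [/\ a <> 0, u \in unitmx, E u, E (invmx u) & g = a *: u]].

Definition Gamma2 (E : set M2) : set M2 :=
  [set g | g \in unitmx /\ conj_by g @` E = E].

Definition embedding_orbits (E H G : set M2) : set (set (H -> M2)) :=
  classes_of (optimal_embeddings E H)
    (fun f f' => exists2 g, G g & f' = fun x => conj_by g (f x)).

Arguments embedding_orbits E H G _ : clear implicits.

Definition suborder_orbits (E H G : set M2) : set (set (set M2)) :=
  classes_of (optimal_suborders E H)
    (fun A A' => exists2 g, G g & A' = conj_by g @` A).

Definition embedding_numbers (E H : set M2) (e : nat * nat * nat * nat) :=
  let: (e1, e2, e3, e4) := e in
  [/\ embedding_orbits E H (Gamma1 E) #= `I_e1,
      embedding_orbits E H (Gamma2 E) #= `I_e2,
      suborder_orbits E H (Gamma1 E) #= `I_e3 &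
      suborder_orbits E H (Gamma2 E) #= `I_e4].

End Orders.

Arguments optimal_embeddings {k} E H _.
Arguments embedding_orbits {k} E H G _.

(* Main.v *)
(* Every embedding of the upper triangular algebra T into M_2(k) is conjugation
   by some g in GL_2(k), unique up to scalars, and every Eichler order of level r
   is conjugate to E_r = [[O, O], [pi^r O, O]]. So one has to find the g such that
   T meets g^-1 E_r g exactly in H, modulo K = k^* E_r^* or the normalizer of E_r
   on the left and, for suborders, modulo the normalizer N of H on the right.
   Write g = e U_j b with e in K, U_j = [[1, 0], [pi^j, 1]], 0 <= j <= r, and b
   upper triangular. Comparing T and g^-1 E_r g entrywise forces 2t <= r and
   j = t or j = r - t, and yields that these g form K Z N together with K w Z N,
   where Z = [[1, 0], [pi^(r-t), pi^t]] and w = [[0, 1], [pi^r, 0]].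
   For integral upper triangular n with units on the diagonal, Z n Z^-1 is in K
   iff n is in k^* H^*, so K \ K Z N is parametrized by pairs (u, w) in
   (O/pi^t)^* x O/pi^t. The double cosets K Z N and K w Z N are disjoint if
   r > 2t. If r = 2t they coincide, and w acts by (u, w) -> (-u, -w - 1), without
   fixed points when t > 0. The case t = 0 of the same classification shows that
   the normalizer of E_r is K together with K w. *)
Require Import Defs.
From mathcomp Require Import all_boot all_order all_algebra.
From mathcomp Require Import boolp classical_sets functions cardinality.
From mathcomp Require Import ring zify.
Local Open Scope classical_set_scope.
Local Open Scope ring_scope.
Local Open Scope card_scope.

Set Implicit Arguments.
Unset Strict Implicit.
Unset Printing Implicit Defensive.

Import Order.TTheory GRing.Theory Num.Theory.

(** * Valuations *)

(** An embedding determines its conjugator up to the centralizer of H, which is k^* and lies in both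
    acting groups; so orbits of embeddings are exactly cosets of conjugators. For g = U_j b,
    integral scalars belong both to H and to the pulled-back order, so the condition on upper
    triangular matrices is an equality of two lattices in k^2, with coordinates the difference x of
    the diagonal entries and the upper right entry c of the conjugate. A few test vectors then pin j
    and show that b is integral after rescaling. For t > 0 the number of pairs (u, w) is
    (p-1)p^(t-1) times p^t. The normalizer of H consists of the scalar multiples of the integral
    matrices [[u, w], [0, 1]] with u a unit; it permutes these pairs transitively, so suborders only
    see the double cosets. If these coincided for r > 2t, a unit would be divisible by pi^(r-2t).
    The standard form of E comes from a lattice stable under a maximal order and from the Smith
    normal form of the matrix relating two such lattices. *)

Section Valuation.
Variables (k : fieldType) (v : k -> int).
Hypothesis hk : local_field v.
Local Notation I := (val_ideal v).

Lemma val_mul x y : x != 0 -> y != 0 -> v (x * y) = v x + v y.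
Proof. by move=> /eqP x0 /eqP y0; apply: Defs.valM. Qed.

Lemma val1 : v 1 = 0.
Proof.
have n0 : (1 : k) != 0 := oner_neq0 k.
by have := val_mul n0 n0; rewrite mulr1 => h; lia.
Qed.

Lemma valV x : x != 0 -> v x^-1 = - v x.
Proof.
move=> x0; have V0 : x^-1 != 0 by rewrite invr_eq0.
by have := val_mul x0 V0; rewrite divff // val1 => h; lia.
Qed.

Lemma valN x : x != 0 -> v (- x) = v x.
Proof.
move=> x0; have n0 : (-1 : k) != 0 by rewrite oppr_eq0 oner_eq0.
have := val_mul n0 n0; rewrite mulrNN mulr1 val1 => h.
by rewrite -mulN1r val_mul //; lia.
Qed.

Lemma val_ideal0 n : I n 0. Proof. by left. Qed.

Lemma val_ideal_nz n x : x != 0 -> I n x -> n <= v x.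
Proof. by move=> /eqP x0 []. Qed.

Lemma val_idealW m n x : m <= n -> I n x -> I m x.
Proof. by move=> mn [->|nx]; [left|right; lia]. Qed.

Lemma val_idealN n x : I n x -> I n (- x).
Proof.
move=> [->|nx]; first by rewrite oppr0; left.
by have [->|x0] := eqVneq x 0; [rewrite oppr0; left|right; rewrite valN].
Qed.

Lemma val_idealD n x y : I n x -> I n y -> I n (x + y).
Proof.
have [->|x0] := eqVneq x 0; first by rewrite add0r.
have [->|y0] := eqVneq y 0; first by rewrite addr0.
have [->|xy0] := eqVneq (x + y) 0; first by left.
move=> /(val_ideal_nz x0) nx /(val_ideal_nz y0) ny; right.
apply: le_trans (Defs.valD hk (elimN eqP x0) (elimN eqP y0) (elimN eqP xy0)).
by rewrite le_min nx ny.
Qed.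

Lemma val_idealB n x y : I n x -> I n y -> I n (x - y).
Proof. by move=> nx /val_idealN; apply: val_idealD. Qed.

Lemma val_idealM m n x y : I m x -> I n y -> I (m + n) (x * y).
Proof.
have [->|x0] := eqVneq x 0; first by rewrite mul0r; left.
have [->|y0] := eqVneq y 0; first by rewrite mulr0; left.
move=> /(val_ideal_nz x0) nx /(val_ideal_nz y0) ny; right.
by rewrite val_mul //; lia.
Qed.

Lemma integersMl n x y : I 0 x -> I n y -> I n (x * y).
Proof. by move=> x0 /(val_idealM x0); rewrite add0r. Qed.

Lemma integersMr n x y : I n x -> I 0 y -> I n (x * y).
Proof. by move=> nx /(val_idealM nx); rewrite addr0. Qed.

Lemma integers1 : I 0 1. Proof. by right; rewrite val1. Qed.

Definition unitO (x : k) := (x != 0) && (v x == 0).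

Lemma unitOP x : unitO x -> [/\ x != 0, I 0 x & I 0 x^-1].
Proof.
by case/andP=> x0 /eqP vx; split=> //; right; rewrite ?valV // vx.
Qed.

Lemma unitO_intro x : x != 0 -> I 0 x -> I 0 x^-1 -> unitO x.
Proof.
move=> x0 /(val_ideal_nz x0) h1 /(val_ideal_nz (invr_neq0 x0)).
by rewrite valV // => h2; rewrite /unitO x0; apply/eqP; lia.
Qed.

Lemma unitO1 : unitO 1.
Proof. by rewrite /unitO oner_eq0 val1. Qed.

Lemma unitON x : unitO x -> unitO (- x).
Proof. by case/andP=> x0 vx; rewrite /unitO oppr_eq0 x0 valN. Qed.

Lemma unitOV x : unitO x -> unitO x^-1.
Proof.
by case/andP=> x0 /eqP vx; rewrite /unitO invr_eq0 x0 valV // vx.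
Qed.

Lemma unitOM x y : unitO x -> unitO y -> unitO (x * y).
Proof.
case/andP=> x0 /eqP vx; case/andP=> y0 /eqP vy.
by rewrite /unitO mulf_eq0 negb_or x0 y0 val_mul // vx vy.
Qed.

Lemma unitOMr n x u : unitO u -> I n (x * u) <-> I n x.
Proof.
move=> /unitOP[u0 uO uV]; split=> [h|h]; last exact: integersMr.
by rewrite -(mulfK u0 x); apply: integersMr.
Qed.

Lemma unitOMl n x u : unitO u -> I n (u * x) <-> I n x.
Proof. by rewrite mulrC; apply: unitOMr. Qed.

Lemma nonunitO x : I 0 x -> ~~ unitO x -> I 1 x.
Proof.
have [->|x0] := eqVneq x 0; first by left.
by rewrite /unitO x0 => -[/eqP|]; [rewrite (negbTE x0)|move=> h ?; right; lia].
Qed.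

Lemma unitO_val_ideal1 x : unitO x -> ~ I 1 x.
Proof. by case/andP=> /eqP x0 /eqP vx [//|]; rewrite vx. Qed.

Lemma unitO_congr x y : unitO x -> I 1 (x - y) -> unitO y.
Proof.
move=> ux xy.
have yO : I 0 y.
  rewrite -[y](subKr x); apply: val_idealB; first by case: (unitOP ux).
  exact: val_idealW xy.
case: (boolP (unitO y)) => // /(nonunitO yO) y1.
by case: (unitO_val_ideal1 ux); rewrite -[x](subrK y); apply: val_idealD.
Qed.

Variable pi : k.
Hypothesis hpi : uniformizer v pi.

Lemma unif_neq0 : pi != 0. Proof. by apply/eqP; case: hpi. Qed.

Lemma expu_neq0 n : pi ^+ n != 0. Proof. by rewrite expf_neq0 // unif_neq0. Qed.

Lemma valX n : v (pi ^+ n) = n%:Z.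
Proof.
elim: n => [|n IH]; first by rewrite expr0 val1.
rewrite exprS val_mul ?unif_neq0 ?expu_neq0 // IH.
by case: hpi => _ ->; lia.
Qed.

Lemma val_ideal_expu m n : I m (pi ^+ n) <-> m <= n%:Z.
Proof.
split=> [[/eqP|]|h]; last by right; rewrite valX.
  by rewrite (negbTE (expu_neq0 n)).
by rewrite valX.
Qed.

Lemma val_ideal_Mexpu m n x : I m (pi ^+ n * x) <-> I (m - n%:Z) x.
Proof.
have [->|x0] := eqVneq x 0; first by rewrite mulr0; split; left.
have y0 : pi ^+ n * x != 0 by rewrite mulf_neq0 // expu_neq0.
have E : v (pi ^+ n * x) = n%:Z + v x.
  by rewrite val_mul ?expu_neq0 // valX.
by split=> [/(val_ideal_nz y0)|/(val_ideal_nz x0)] h; right; lia.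
Qed.

Lemma val_ideal_divexpu m n x : I m (x / pi ^+ n) <-> I (m + n%:Z) x.
Proof.
have -> : m = m + n%:Z - n%:Z by lia.
rewrite -val_ideal_Mexpu mulrCA mulfV ?expu_neq0 // mulr1.
by have -> : m + n%:Z - n%:Z + n%:Z = m + n%:Z by lia.
Qed.

Lemma val_ideal_factor n x : I n%:Z x -> exists2 y, I 0 y & x = pi ^+ n * y.
Proof.
move=> nx; exists (x / pi ^+ n); first by rewrite val_ideal_divexpu add0r.
by rewrite mulrCA mulfV ?expu_neq0 // mulr1.
Qed.

Lemma val_large x : exists n : nat, I 0 (pi ^+ n * x).
Proof.
by exists `|v x|%N; apply/val_ideal_Mexpu; right; lia.
Qed.

End Valuation.

(** * Two by two matrices and standard orders *)

Section Matrix2.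
Variable k : fieldType.
Local Notation M2 := 'M[k]_2.

Definition mx2 (a b c d : k) : M2 :=
  \matrix_(i, j) if i == 0 then (if j == 0 then a else b)
                 else (if j == 0 then c else d).

Lemma mx2_00 a b c d : mx2 a b c d 0 0 = a. Proof. by rewrite mxE. Qed.
Lemma mx2_01 a b c d : mx2 a b c d 0 1 = b. Proof. by rewrite mxE. Qed.
Lemma mx2_10 a b c d : mx2 a b c d 1 0 = c. Proof. by rewrite mxE. Qed.
Lemma mx2_11 a b c d : mx2 a b c d 1 1 = d. Proof. by rewrite mxE. Qed.
Definition mx2E := (mx2_00, mx2_01, mx2_10, mx2_11).

Lemma ord2_cases (i : 'I_2) : i = 0 \/ i = 1.
Proof. by case: i => [[|[|//]]] hi; [left|right]; apply: val_inj. Qed.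

Lemma matrix2P (x y : M2) : x 0 0 = y 0 0 -> x 0 1 = y 0 1 -> x 1 0 = y 1 0 ->
  x 1 1 = y 1 1 -> x = y.
Proof.
move=> h1 h2 h3 h4; apply/matrixP => i j.
by case: (ord2_cases i) => ->; case: (ord2_cases j) => ->.
Qed.

Lemma mx2_eta (x : M2) : x = mx2 (x 0 0) (x 0 1) (x 1 0) (x 1 1).
Proof. by apply: matrix2P; rewrite mx2E. Qed.

Lemma mx2_ind (P : M2 -> Prop) : (forall a b c d, P (mx2 a b c d)) -> forall x, P x.
Proof. by move=> h x; rewrite [x]mx2_eta. Qed.

Lemma mx2_inj a b c d a' b' c' d' : mx2 a b c d = mx2 a' b' c' d' ->
  [/\ a = a', b = b', c = c' & d = d'].
Proof.
move=> e; split.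
- by have := congr1 (fun x : M2 => x 0 0) e; rewrite !mx2E.
- by have := congr1 (fun x : M2 => x 0 1) e; rewrite !mx2E.
- by have := congr1 (fun x : M2 => x 1 0) e; rewrite !mx2E.
- by have := congr1 (fun x : M2 => x 1 1) e; rewrite !mx2E.
Qed.

Lemma mx2M a b c d a' b' c' d' : mx2 a b c d *m mx2 a' b' c' d' =
  mx2 (a * a' + b * c') (a * b' + b * d') (c * a' + d * c') (c * b' + d * d').
Proof.
have E : lift ord0 ord0 = 1 :> 'I_2 by apply: val_inj.
by apply: matrix2P; rewrite mxE !big_ord_recl big_ord0 addr0 E !mx2E.
Qed.

Lemma mx2Z l a b c d : l *: mx2 a b c d = mx2 (l * a) (l * b) (l * c) (l * d).
Proof. by apply: matrix2P; rewrite mxE !mx2E. Qed.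

Lemma mx2D a b c d a' b' c' d' :
  mx2 a b c d + mx2 a' b' c' d' = mx2 (a + a') (b + b') (c + c') (d + d').
Proof. by apply: matrix2P; rewrite mxE !mx2E. Qed.

Lemma mx2_scalar a : a%:M = mx2 a 0 0 a.
Proof. by apply: matrix2P; rewrite mxE !mx2E. Qed.

Lemma mx2_0 : 0 = mx2 0 0 0 0.
Proof. by apply: matrix2P; rewrite mxE !mx2E. Qed.

Lemma mx2_det a b c d : \det (mx2 a b c d) = a * d - b * c.
Proof.
rewrite (expand_det_row _ 0) !big_ord_recl big_ord0 addr0 /cofactor !det_mx11.
by rewrite !mxE /=; ring.
Qed.

Lemma mx2_unit a b c d : (mx2 a b c d \in unitmx) = (a * d - b * c != 0).
Proof. by rewrite unitmxE unitfE mx2_det. Qed.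

Lemma invmx_unique (n : nat) (x y : 'M[k]_n) : x *m y = 1%:M -> invmx x = y.
Proof.
move=> xy; have [ux _] := mulmx1_unit xy.
by rewrite -[y](mulKmx ux) xy mulmx1.
Qed.

Lemma mx2V a b c d : a * d - b * c != 0 -> invmx (mx2 a b c d) =
  (a * d - b * c)^-1 *: mx2 d (- b) (- c) a.
Proof.
move=> D0; apply: invmx_unique; rewrite mx2Z mx2M mx2_scalar.
by congr mx2; field.
Qed.

Implicit Types g h x y : M2.

(** Clearing the inverse reduces an explicit conjugation to polynomial identities between
    entries. *)
Lemma conj_by_eq g x y : g \in unitmx -> conj_by g x = y <-> g *m x = y *m g.
Proof.
move=> ug; split=> [<-|e]; first by rewrite /conj_by mulmxKV.
by rewrite /conj_by e mulmxK.
Qed.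

Lemma conj_by1 x : conj_by 1%:M x = x.
Proof. by rewrite /conj_by invmx1 mul1mx mulmx1. Qed.

Lemma invmxM g h : g \in unitmx -> h \in unitmx ->
  invmx (g *m h) = invmx h *m invmx g.
Proof.
move=> ug uh; apply: invmx_unique.
by rewrite mulmxA mulmxK // mulmxV.
Qed.

Lemma conj_byM g h x : g \in unitmx -> h \in unitmx ->
  conj_by (g *m h) x = conj_by g (conj_by h x).
Proof. by move=> ug uh; rewrite /conj_by invmxM // !mulmxA. Qed.

Lemma conj_byK g : g \in unitmx -> cancel (conj_by g) (conj_by (invmx g)).
Proof.
by move=> ug x; rewrite -conj_byM ?unitmx_inv // mulVmx // conj_by1.
Qed.

Lemma conj_byVK g : g \in unitmx -> cancel (conj_by (invmx g)) (conj_by g).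
Proof.
by move=> ug x; rewrite -conj_byM ?unitmx_inv // mulmxV // conj_by1.
Qed.

Lemma conj_by_mul g x y : g \in unitmx ->
  conj_by g (x *m y) = conj_by g x *m conj_by g y.
Proof. by move=> ug; rewrite /conj_by !mulmxA mulmxKV. Qed.

Lemma conj_by_add g x y : conj_by g (x + y) = conj_by g x + conj_by g y.
Proof. by rewrite /conj_by mulmxDr mulmxDl. Qed.

Lemma conj_by_scale g a x : conj_by g (a *: x) = a *: conj_by g x.
Proof. by rewrite /conj_by -scalemxAr -scalemxAl. Qed.

Lemma conj_by_one g : g \in unitmx -> conj_by g 1%:M = 1%:M.
Proof. by move=> ug; rewrite /conj_by mulmx1 mulmxV. Qed.

Lemma unitmx_scale a g : a != 0 -> g \in unitmx -> a *: g \in unitmx.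
Proof. by move=> a0; rewrite !unitmxE !unitfE detZ => ug; rewrite mulf_neq0 ?expf_neq0. Qed.

Lemma conj_byZ a g x : a != 0 -> g \in unitmx -> conj_by (a *: g) x = conj_by g x.
Proof.
move=> a0 ug; apply/conj_by_eq; first exact: unitmx_scale.
by rewrite -scalemxAl -scalemxAr /conj_by mulmxKV.
Qed.

Lemma image_conj_by g (A : set M2) x : g \in unitmx ->
  (conj_by g @` A) x <-> A (conj_by (invmx g) x).
Proof.
move=> ug; split=> [[y Ay <-]|Ax]; first by rewrite conj_byK.
by exists (conj_by (invmx g) x) => //; rewrite conj_byVK.
Qed.

Lemma image_conj_byP g (A B : set M2) : g \in unitmx ->
  conj_by g @` A = B <-> forall x, A x <-> B (conj_by g x).
Proof.
move=> ug; split=> [<- x|h].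
  by rewrite image_conj_by // conj_byK.
by apply/seteqP; split=> x; rewrite image_conj_by // h conj_byVK.
Qed.

End Matrix2.

(** * The orders E_r and H in coordinates *)

Section StandardEichler.
Variables (k : fieldType) (v : k -> int).
Hypothesis hk : local_field v.
Variable pi : k.
Hypothesis hpi : uniformizer v pi.
Local Notation I := (val_ideal v).
Local Notation M2 := 'M[k]_2.

Definition eichler0 (r : nat) : set M2 :=
  [set x | [/\ I 0 (x 0 0), I 0 (x 0 1), I r%:Z (x 1 0) & I 0 (x 1 1)]].

Lemma eichler0_mx2 r a b c d :
  eichler0 r (mx2 a b c d) <-> [/\ I 0 a, I 0 b, I r%:Z c & I 0 d].
Proof. by rewrite /eichler0 /= !mx2E. Qed.

Lemma eichler0_1 r : eichler0 r 1%:M.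
Proof.
by rewrite mx2_scalar eichler0_mx2; split; try exact: integers1; left.
Qed.

Lemma eichler0_mul r x y : eichler0 r x -> eichler0 r y -> eichler0 r (x *m y).
Proof.
elim/mx2_ind: x => a b c d; elim/mx2_ind: y => a' b' c' d'.
rewrite mx2M !eichler0_mx2 => -[ha hb hc hd] [ha' hb' hc' hd'].
have rO z : I r%:Z z -> I 0 z by apply: val_idealW; lia.
split; apply: val_idealD => //.
all: try by apply: integersMl => //; auto.
by apply: integersMr.
Qed.

(** The adjugate of an element of E_r is again in E_r, so only the inverse of the determinant
    matters. *)
Lemma eichler0_inv r e : eichler0 r e -> unitO v (\det e) -> eichler0 r (invmx e).
Proof.
elim/mx2_ind: e => a b c d; rewrite mx2_det => /eichler0_mx2[ha hb hc hd] uD.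
have [D0 _ DV] := unitOP hk uD.
rewrite mx2V // mx2Z eichler0_mx2; split; apply: integersMl => //;
  exact: val_idealN.
Qed.

Lemma eichler0_det r e : eichler0 r e -> I 0 (\det e).
Proof.
elim/mx2_ind: e => a b c d; rewrite mx2_det => /eichler0_mx2[ha hb hc hd].
apply: val_idealB => //; apply: integersMl => //.
by apply: val_idealW hc; lia.
Qed.

Lemma eichler0_det_unit r e : e \in unitmx -> eichler0 r e ->
  eichler0 r (invmx e) -> unitO v (\det e).
Proof.
move=> ue /eichler0_det h1 /eichler0_det; rewrite det_inv => h2.
by apply: unitO_intro => //; move: ue; rewrite unitmxE unitfE.
Qed.

Definition upper_pi t : set M2 := order_level v pi t (upper_order v).

Lemma upper_pi_mx2 t a b c d : upper_pi t (mx2 a b c d) <->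
  [/\ I 0 a, I 0 d, c = 0, I t%:Z b & I t%:Z (a - d)].
Proof.
split=> [[e eO [y [y0 y1 y2 y3]]]|[ha hd -> hb had]].
  rewrite [y]mx2_eta mx2_scalar mx2Z mx2D => /mx2_inj[<- <- <- <-].
  have tO z : I 0 z -> I t%:Z (pi ^+ t * z).
    by move=> h; rewrite val_ideal_Mexpu // subrr.
  have tW z : I t%:Z z -> I 0 z by apply: val_idealW; lia.
  split.
  - by apply: val_idealD => //; apply: tW; apply: tO.
  - by apply: val_idealD => //; apply: tW; apply: tO.
  - by rewrite y2 mulr0 addr0.
  - by rewrite add0r; apply: tO.
  have -> : e + pi ^+ t * y 0 0 - (e + pi ^+ t * y 1 1) =
            pi ^+ t * (y 0 0 - y 1 1) by ring.
  by apply: tO; apply: val_idealB.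
have [b' hb' ->] := val_ideal_factor hk hpi hb.
have [e he E] := val_ideal_factor hk hpi had.
(* The lower right entry serves as the scalar part, which leaves 0 in that corner of the
   pi^t-part. *)
exists d => //; exists (mx2 e b' 0 0).
  by rewrite /upper_order /= !mx2E; split => //; left.
rewrite mx2_scalar mx2Z mx2D; congr mx2; rewrite ?mulr0 ?addr0 ?add0r //.
by rewrite -E; ring.
Qed.

End StandardEichler.

(** * Classification of optimal conjugators *)

(* Those g for which conjugation by g embeds H optimally into E, when the span
   of H is the algebra of upper triangular matrices. *)
Definition optimal_conj (k : fieldType) (E H : set 'M[k]_2) : set 'M[k]_2 :=
  [set g | g \in unitmx /\ forall x : 'M[k]_2, x 1 0 = 0 -> E (conj_by g x) <-> H x].

(** * The groups k^* E^* and the normalizer of E *)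

Section ConjugationGroups.
Variable k : fieldType.
Local Notation M2 := 'M[k]_2.
Implicit Types (E : set M2) (g h : M2).

Lemma Gamma1_unitmx E g : Gamma1 E g -> g \in unitmx.
Proof. by move=> [a [u [/eqP a0 uu _ _ ->]]]; apply: unitmx_scale. Qed.

Lemma Gamma1Z E (a : k) g : a != 0 -> Gamma1 E g -> Gamma1 E (a *: g).
Proof.
move=> a0 [b [u [/eqP b0 uu Eu EV ->]]]; exists (a * b), u.
by split; rewrite ?scalerA //; apply/eqP; rewrite mulf_neq0.
Qed.

Lemma Gamma1_inv E g : Gamma1 E g -> Gamma1 E (invmx g).
Proof.
move=> [b [u [/eqP b0 uu Eu EV ->]]]; exists b^-1, (invmx u).
split; rewrite ?unitmx_inv ?invmxK //; first by apply/eqP; rewrite invr_eq0.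
by rewrite invmxZ // unitmx_scale.
Qed.

Lemma Gamma1_mul E g h : (forall x y, E x -> E y -> E (x *m y)) ->
  Gamma1 E g -> Gamma1 E h -> Gamma1 E (g *m h).
Proof.
move=> EM [b [u [/eqP b0 uu Eu EV ->]]] [c [x [/eqP c0 ux Ex EW ->]]].
exists (b * c), (u *m x); split.
- by apply/eqP; rewrite mulf_neq0.
- by rewrite unitmx_mul uu.
- exact: EM.
- by rewrite invmxM //; apply: EM.
- by rewrite -scalemxAl -scalemxAr scalerA.
Qed.

Lemma Gamma2P E g : Gamma2 E g <->
  g \in unitmx /\ (forall x : M2, E x <-> E (conj_by g x)).
Proof.
by split=> -[ug h]; split => //; apply/(image_conj_byP _ _ ug).
Qed.

Lemma Gamma2_inv E g : Gamma2 E g -> Gamma2 E (invmx g).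
Proof.
move=> /Gamma2P[ug h]; apply/Gamma2P; rewrite unitmx_inv; split=> // x.
by rewrite (h (conj_by _ x)) conj_byVK.
Qed.

Lemma Gamma2_mul E g h : Gamma2 E g -> Gamma2 E h -> Gamma2 E (g *m h).
Proof.
move=> /Gamma2P[ug gE] /Gamma2P[uh hE]; apply/Gamma2P.
by rewrite unitmx_mul ug; split=> // x; rewrite conj_byM // -gE -hE.
Qed.

Lemma Gamma1_sub E g : (forall x y, E x -> E y -> E (x *m y)) ->
  Gamma1 E g -> Gamma2 E g.
Proof.
move=> EM [b [u [/eqP b0 uu Eu EV ->]]]; apply/Gamma2P.
split=> [|x]; first exact: unitmx_scale.
rewrite conj_byZ //; split=> [Ex|Ex]; first exact: EM (EM _ _ Eu Ex) EV.
by rewrite -(conj_byK uu x) {1}/conj_by invmxK; exact: EM (EM _ _ EV Ex) Eu.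
Qed.

(** Conjugation by an element of the normalizer permutes the units of E. This allows a factor in K
    to be moved past the swap w. *)
Lemma Gamma1_conj E g h : Gamma2 E g -> Gamma1 E h -> Gamma1 E (conj_by g h).
Proof.
move=> /Gamma2P[ug gE] [b [u [b0 uu Eu EV ->]]]; exists b, (conj_by g u).
have uc : conj_by g u \in unitmx by rewrite !unitmx_mul ug uu unitmx_inv.
split; rewrite ?conj_by_scale // -?gE //.
suff -> : invmx (conj_by g u) = conj_by g (invmx u) by rewrite -gE.
by apply: invmx_unique; rewrite -conj_by_mul // mulmxV // conj_by_one.
Qed.

End ConjugationGroups.

(** * Iwasawa decomposition and the lattice test *)

Section Classification.
Variables (k : fieldType) (v : k -> int).
Hypothesis hk : local_field v.
Variable pi : k.
Hypothesis hpi : uniformizer v pi.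
Local Notation I := (val_ideal v).
Local Notation M2 := 'M[k]_2.
Local Notation eichler0 := (eichler0 v).
Local Notation upper_pi := (upper_pi v pi).

Lemma optimal_conj_mull (E H : set M2) g h :
  Gamma2 E g -> optimal_conj E H h -> optimal_conj E H (g *m h).
Proof.
move=> [ug /image_conj_byP gE] [uh hH]; split=> [|x x0].
  by rewrite unitmx_mul ug.
by rewrite conj_byM // -hH // -gE.
Qed.

(** An invertible upper triangular matrix modulo scalars, as the affine map x -> u x + w. *)
Definition affmx (u w : k) : M2 := mx2 u w 0 1.
Definition swapmx (r : nat) : M2 := mx2 0 1 (pi ^+ r) 0.
Definition swappow r (b : bool) : M2 := if b then swapmx r else 1%:M.
Definition basemx (r t : nat) : M2 := mx2 1 0 (pi ^+ (r - t)) (pi ^+ t).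

(** The conjugator is [[1, 0], [s, 1]] times [affmx u w]: the affine factor keeps the diagonal and
    turns b into c, and the lower unipotent factor then acts on the result. For s = pi^j it is the
    U_j b of the decomposition. *)
Lemma conj_by_iwasawa (s u w a b d : k) : u != 0 ->
  conj_by (mx2 u w (s * u) (s * w + 1)) (mx2 a b 0 d) =
  let c := u * b + w * (d - a) in
  mx2 (a - s * c) c (s * (a - d - s * c)) (s * c + d).
Proof.
move=> u0 /=; apply/conj_by_eq; last by rewrite !mx2M; congr mx2; ring.
by rewrite mx2_unit; have -> : u * (s * w + 1) - w * (s * u) = u by ring.
Qed.

Lemma Gamma1_eichler0 r (a : k) (e : M2) : a != 0 -> eichler0 r e -> unitO v (\det e) ->
  Gamma1 (eichler0 r) (a *: e).
Proof.
move=> /eqP a0 he ud; exists a, e; split => //; last exact: eichler0_inv.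
by rewrite unitmxE unitfE; case/andP: ud.
Qed.

(** The first column (x, z) is a point of the projective line, whose K-orbits are represented by (1
    : pi^j) with j the valuation of z / x truncated to the interval from 0 to r. Scalars belong to
    K, so the second column can be normalized as well. *)
Lemma iwasawa r g : g \in unitmx -> exists e (j : nat) (u w : k),
  [/\ Gamma1 (eichler0 r) e, (j <= r)%N, u != 0 &
      g = e *m mx2 u w (pi ^+ j * u) (pi ^+ j * w + 1)].
Proof.
have pX n := expu_neq0 hpi n.
have O0 n := val_ideal0 v n.
have O1 := integers1 hk.
(* Once the first column is proportional to (1, pi^j), dividing by l = q - pi^j y brings the second
   column to the form (w, pi^j w + 1). *)
have main e j x y q : eichler0 r e -> unitO v (\det e) -> (j <= r)%N ->
    x * q - y * (pi ^+ j * x) != 0 -> exists e' (i : nat) (u w : k),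
    [/\ Gamma1 (eichler0 r) e', (i <= r)%N, u != 0 &
      e *m mx2 x y (pi ^+ j * x) q =
      e' *m mx2 u w (pi ^+ i * u) (pi ^+ i * w + 1)].
  move=> he ud jr.
  have -> : x * q - y * (pi ^+ j * x) = x * (q - pi ^+ j * y) by ring.
  rewrite mulf_eq0 negb_or => /andP[x0 l0]; set l := q - _ in l0.
  exists (l *: e), j, (x / l), (y / l); split => //.
  - exact: Gamma1_eichler0.
  - by rewrite mulf_neq0 // invr_eq0.
  rewrite -scalemxAl scalemxAr mx2Z; congr (_ *m mx2 _ _ _ _).
  - by rewrite mulrCA mulfV // mulr1.
  - by rewrite mulrCA mulfV // mulr1.
  - by rewrite mulrCA; congr (_ * _); rewrite mulrCA mulfV // mulr1.
  - rewrite mulrDr mulr1 mulrCA [l * _]mulrCA mulfV // mulr1 /l; ring.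
elim/mx2_ind: g => x y z q; rewrite mx2_unit => D0.
(* When x / z is integral, a shear by s - 1 moves the column (s z, z) to (z, z), which is the case j
   = 0. *)
have [zx|xz] := pselect (z != 0 /\ I 0 (x / z)).
  case: zx => z0 sO; set s := x / z in sO.
  have xE : x = s * z by rewrite /s divfK.
  have -> : mx2 x y z q = mx2 1 (s - 1) 0 1 *m
      mx2 z (y + (1 - s) * q) (pi ^+ 0 * z) q.
    by rewrite mx2M xE expr0; congr mx2; ring.
  apply: main => //.
  - by rewrite eichler0_mx2; split => //; apply: val_idealB.
  - by rewrite mx2_det mulr0 subr0 mulr1 unitO1.
  by have <- : x * q - y * z = z * q - (y + (1 - s) * q) * (pi ^+ 0 * z);
    first by rewrite xE expr0; ring.
have x0 : x != 0.
  apply/eqP => x0; case: xz; split; last by rewrite x0 mul0r.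
  by apply/eqP => z0; move: D0; rewrite x0 z0 mulr0 mul0r subr0 eqxx.
have sO : I 0 (z / x).
  have [->|z0] := eqVneq z 0; first by rewrite mul0r.
  right; rewrite (val_mul hk) ?invr_eq0 // (valV hk) //.
  have : ~ (0 <= v (x / z)) by move=> h; apply: xz; split => //; right.
  by rewrite (val_mul hk) ?invr_eq0 // (valV hk) //; lia.
set s := z / x in sO.
have zE : z = s * x by rewrite /s divfK.
(* A ratio in pi^r O is replaced by pi^r itself through a lower unipotent element of E_r. *)
have [rs|rs] := pselect (I r%:Z s).
  have -> : mx2 x y z q = mx2 1 0 (s - pi ^+ r) 1 *m
      mx2 x y (pi ^+ r * x) (q - (s - pi ^+ r) * y).
    by rewrite mx2M zE; congr mx2; ring.
  apply: main => //.
  - rewrite eichler0_mx2; split => //; apply: val_idealB => //.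
    by apply/(val_ideal_expu hk hpi).
  - by rewrite mx2_det mul0r subr0 mulr1 unitO1.
  by have <- : x * q - y * z =
    x * (q - (s - pi ^+ r) * y) - y * (pi ^+ r * x);
    first by rewrite zE; ring.
have s0 : s != 0 by apply/eqP => s0; apply: rs; rewrite s0.
have [j js] : exists j : nat, v s = j%:Z.
  by move: (val_ideal_nz s0 sO); case: (v s) => // n _; exists n.
have jr : (j <= r)%N.
  have : ~ (r%:Z <= v s) by move=> h; apply: rs; right.
  by rewrite js; lia.
(* The unit part of the ratio is absorbed by the diagonal matrix with entries 1 and c. *)
set c := s / pi ^+ j.
have uc : unitO v c.
  rewrite /unitO mulf_neq0 ?invr_eq0 //= (val_mul hk) ?invr_eq0 //.
  rewrite (valV hk) // (valX hk hpi) js; apply/eqP; lia.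
have [c0 cO _] := unitOP hk uc.
have sE : s = c * pi ^+ j by rewrite /c divfK.
have -> : mx2 x y z q = mx2 1 0 0 c *m mx2 x y (pi ^+ j * x) (q / c).
  by rewrite mx2M zE sE; congr mx2; try ring; field.
apply: main => //.
- by rewrite eichler0_mx2.
- by rewrite mx2_det mulr0 subr0 mul1r.
have -> : x * (q / c) - y * (pi ^+ j * x) = (x * q - y * z) / c.
  by rewrite zE sE; field.
by rewrite mulf_neq0 // invr_eq0.
Qed.

(* Here [x] is the difference of the diagonal entries of an upper triangular
   matrix and [c] the upper right entry of its conjugate. *)
Lemma optimal_iwasawa r t (j : nat) u w x c : u != 0 -> (j <= r)%N ->
  optimal_conj (eichler0 r) (upper_pi t)
    (mx2 u w (pi ^+ j * u) (pi ^+ j * w + 1)) ->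
  (I 0 c /\ I (r%:Z - j%:Z) (x - pi ^+ j * c)) <->
  (I t%:Z x /\ I t%:Z ((c + w * x) / u)).
Proof.
(* Integral scalars change neither side, so the lower right entry is set to 0; the upper right entry
   b solves u b - w x = c. *)
move=> u0 jr [_ /(_ (mx2 x ((c + w * x) / u) 0 0))]; rewrite mx2_10.
move=> /(_ erefl); rewrite conj_by_iwasawa // eichler0_mx2.
rewrite (upper_pi_mx2 hk hpi) subr0 sub0r.
have -> : u * ((c + w * x) / u) + w * - x = c by field.
rewrite addr0 => E; have O0 n := val_ideal0 v n.
have M := val_ideal_Mexpu hk hpi r%:Z j (x - pi ^+ j * c).
split=> [[cO xc]|[xt ct]].
  have jcO : I 0 (pi ^+ j * c).
    by apply: integersMl => //; apply/(val_ideal_expu hk hpi); lia.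
  have xcO : I 0 (x - pi ^+ j * c) by apply: val_idealW xc; lia.
  by case: E => [[|//]]; first by split => //; apply/M.
have xO : I 0 x by apply: val_idealW xt; lia.
by case: E => _ [|_ cO /M h _] //; split.
Qed.

(** Left factors from K normalize E_r and may be dropped, which leaves the lattice equality of
    [optimal_iwasawa]. Each use of [test] evaluates it at one pair (x, c): pairs with x nonzero
    compare j with t and bound w, and pairs with x = 0 show that u is a unit up to a power of pi. *)
Lemma optimal_conj_classify r t g :
  optimal_conj (eichler0 r) (upper_pi t) g ->
  (2 * t <= r)%N /\ exists e (b : bool) u w,
    [/\ Gamma1 (eichler0 r) e, unitO v u, I 0 w &
      g = e *m (swappow r b *m (basemx r t *m affmx u w))].
Proof.
move=> Pg; have ug : g \in unitmx by case: Pg.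
have [e [j [u [w [Ke jr u0 gE]]]]] := iwasawa r ug.
have pX n := expu_neq0 hpi n.
have O0 n := val_ideal0 v n.
have O1 := integers1 hk.
have XO m n : m <= n%:Z -> I m (pi ^+ n) by move/(val_ideal_expu hk hpi).
have OX m n : I m (pi ^+ n) -> m <= n%:Z by move/(val_ideal_expu hk hpi).
have [a [e0 [/eqP a0 ue0 he0 he0V eE]]] := Ke.
have K2 : Gamma2 (eichler0 r) (invmx e).
  by apply/Gamma2_inv/Gamma1_sub => //; apply: eichler0_mul.
have ue : e \in unitmx by rewrite eE; apply: unitmx_scale.
have {}Pg : optimal_conj (eichler0 r) (upper_pi t)
    (mx2 u w (pi ^+ j * u) (pi ^+ j * w + 1)).
  by have := optimal_conj_mull K2 Pg; rewrite gE mulKmx.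
have test x c := optimal_iwasawa x c u0 jr Pg.
have KZ (d : k) : d != 0 -> Gamma1 (eichler0 r) (d *: e).
  move=> d0; exists (d * a), e0; rewrite eE scalerA; split => //.
  by apply/eqP; rewrite mulf_neq0.
(* For 2j <= r the tests force j = t and the coset of [swapmx r *m basemx r t]; otherwise they force
   j = r - t and the coset of [basemx r t]. When r = 2t only the first case occurs. *)
have [j2|j2] := leqP (2 * j) r.
  have tj : (t <= j)%N.
    case: (test (pi ^+ j) 1) => -[|/OX]; last by lia.
    by rewrite mulr1 subrr.
  have {tj} jt : j = t.
    apply/eqP; rewrite eqn_leq tj andbT.
    (* This pair has c + w x = 0, so it satisfies the right-hand condition whatever u is. The
       left-hand one then makes w pi^t integral and, as r - j >= j, puts pi^t in pi^j O. *)
    case: (test (pi ^+ t) (- (w * pi ^+ t))) => _ [|cO].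
      by rewrite addNr mul0r; split => //; apply: XO.
    move=> h; have : I j%:Z (pi ^+ t); last by move/OX; lia.
    rewrite -[pi ^+ t](subrK (pi ^+ j * - (w * pi ^+ t))).
    apply: (val_idealD hk); first by apply: val_idealW h; lia.
    by apply: (integersMr hk) => //; apply: XO.
  subst j; split => //.
  (* The values of [u0'] and [w0] solve U_t b = -pi^(-2t) [swapmx r *m basemx r t *m affmx (- u0')
     w0], where b is [affmx u w]. *)
  set u0' := pi ^+ (2 * t) * u / pi ^+ (r - t).
  have E1 : pi ^+ r = pi ^+ (r - t) * pi ^+ t by rewrite -exprD subnK.
  have E2 : pi ^+ (r - t) = pi ^+ (r - 2 * t) * pi ^+ t.
    by rewrite -exprD; congr (_ ^+ _); lia.
  have E3 : pi ^+ (2 * t) = pi ^+ t * pi ^+ t by rewrite -exprD addnn -mul2n.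
  have uu : unitO v u0'.
    apply: (unitO_intro hk).
    - by rewrite !mulf_neq0 ?invr_eq0.
    - case: (test 0 (u * pi ^+ t)) => _ [|_].
        by rewrite mulr0 addr0 mulrAC divff // mul1r; split => //; apply: XO.
      rewrite sub0r => /val_idealN; rewrite opprK => /(_ hk) h.
      rewrite /u0' (val_ideal_divexpu hk hpi) E3 add0r.
      have -> : pi ^+ t * pi ^+ t * u = pi ^+ t * (u * pi ^+ t) by ring.
      by apply: val_idealW h; lia.
    - case: (test 0 (pi ^+ (r - 2 * t))) => -[|_].
        split; first exact: XO.
        rewrite sub0r -exprD; apply: (val_idealN hk); apply: XO; lia.
      rewrite mulr0 addr0 => h.
      have -> : u0'^-1 = pi ^+ (r - 2 * t) / u / pi ^+ t.
        by rewrite /u0' E3 E2; field; rewrite ?pX ?u0.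
      by rewrite (val_ideal_divexpu hk hpi) add0r.
  have [_ u0O _] := unitOP hk uu.
  set w0 := - ((1 + w * pi ^+ t) / u / pi ^+ t * u0').
  have w0O : I 0 w0.
    apply: (val_idealN hk); apply: (integersMr hk) => //.
    case: (test (pi ^+ t) 1) => -[|_ h].
      by rewrite mulr1 subrr.
    by rewrite (val_ideal_divexpu hk hpi) add0r.
  exists ((- (pi ^+ (2 * t))^-1) *: e), true, (- u0'), w0; split => //.
  - by apply: KZ; rewrite oppr_eq0 invr_eq0 pX.
  - exact: unitON.
  rewrite gE -scalemxAl scalemxAr; congr (_ *m _).
  rewrite /swappow /swapmx /basemx /affmx !mx2M mx2Z; congr mx2;
    rewrite /w0 /u0' ?E1 ?E3 ?E2; field; rewrite ?pX ?u0 //.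
have tj : (t <= r - j)%N.
  case: (test (pi ^+ (r - j)) 0) => -[|/OX]; last by lia.
  by rewrite mulr0 subr0; split => //; apply: XO; lia.
have [wO jt] : I 0 (w * pi ^+ t) /\ (r - j <= t)%N.
  case: (test (pi ^+ t) (- (w * pi ^+ t))) => _ [|cO].
    by rewrite addNr mul0r; split => //; apply: XO.
  move=> h; split; first by rewrite -[_ * _]opprK; apply: (val_idealN hk).
  have : I (r%:Z - j%:Z) (pi ^+ t); last by move/OX; lia.
  rewrite -[pi ^+ t](subrK (pi ^+ j * - (w * pi ^+ t))).
  apply: (val_idealD hk) => //.
  by apply: (integersMr hk) => //; apply: XO; lia.
have {tj jt} jt : j = (r - t)%N by lia.
split; first by lia.
(* Here the equation is U_(r-t) b = pi^(-t) [basemx r t *m affmx u0' (w * pi ^+ t)]. *)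
set u0' := pi ^+ t * u.
have uu : unitO v u0'.
  apply: (unitO_intro hk); first by rewrite mulf_neq0.
  - case: (test 0 (u * pi ^+ t)) => _ [|h _]; last by rewrite /u0' mulrC.
    by rewrite mulr0 addr0 mulrAC divff // mul1r; split => //; apply: XO.
  case: (test 0 1) => -[|_].
    by rewrite sub0r mulr1; split => //; apply: (val_idealN hk); apply: XO; lia.
  rewrite mulr0 addr0 => h.
  have -> : u0'^-1 = 1 / u / pi ^+ t by rewrite /u0'; field; rewrite ?pX ?u0.
  by rewrite (val_ideal_divexpu hk hpi) add0r.
exists ((pi ^+ t)^-1 *: e), false, u0', (w * pi ^+ t); split => //.
- by apply: KZ; rewrite invr_eq0 pX.
rewrite gE -scalemxAl scalemxAr /swappow mul1mx; congr (_ *m _).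
rewrite jt /basemx /affmx !mx2M mx2Z; congr mx2;
  rewrite /u0'; field; rewrite ?pX ?u0 //.
Qed.

End Classification.

(** * Representatives *)

Section Representatives.
Variables (k : fieldType) (v : k -> int).
Hypothesis hk : local_field v.
Variable pi : k.
Hypothesis hpi : uniformizer v pi.
Local Notation I := (val_ideal v).
Local Notation M2 := 'M[k]_2.
Local Notation eichler0 := (eichler0 v).
Local Notation upper_pi := (upper_pi v pi).
Local Notation swapmx := (swapmx pi).
Local Notation swappow := (swappow pi).
Local Notation basemx := (basemx pi).
Implicit Types (a b c d u w : k) (e g h x y : M2).

Lemma affmx_unit u w : u != 0 -> affmx u w \in unitmx.
Proof. by rewrite mx2_unit mulr1 mulr0 subr0. Qed.

Lemma affmx_div u w u' w' : u != 0 ->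
  affmx u' w' *m invmx (affmx u w) = affmx (u' / u) (w' - w * (u' / u)).
Proof.
move=> u0; rewrite mx2V mulr1 mulr0 subr0 // mx2Z mx2M.
by congr mx2; field.
Qed.

Lemma Gamma2_swapmx r : Gamma2 (eichler0 r) (swapmx r).
Proof.
have p0 := expu_neq0 hpi r.
have uw : swapmx r \in unitmx.
  by rewrite mx2_unit mul0r sub0r oppr_eq0 mul1r.
apply/Gamma2P; split => // x; elim/mx2_ind: x => a b c d.
have -> : conj_by (swapmx r) (mx2 a b c d) =
    mx2 d (c / pi ^+ r) (pi ^+ r * b) a.
  by apply/conj_by_eq => //; rewrite !mx2M; congr mx2; field.
rewrite !eichler0_mx2.
have E1 := val_ideal_divexpu hk hpi 0 r c; rewrite add0r in E1.
have E2 := val_ideal_Mexpu hk hpi r%:Z r b; rewrite subrr in E2.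
by split=> -[h1 h2 h3 h4]; split => //; [apply/E1|apply/E2|apply/E2|apply/E1].
Qed.

Lemma swapmx_unit r : swapmx r \in unitmx.
Proof. by case/Gamma2P: (Gamma2_swapmx r). Qed.

Lemma Gamma2_swappow r (b : bool) : Gamma2 (eichler0 r) (swappow r b).
Proof.
case: b; first exact: Gamma2_swapmx.
apply: Gamma1_sub; first exact: eichler0_mul.
have -> : swappow r false = 1 *: 1%:M by rewrite scale1r.
apply: (Gamma1_eichler0 hk); rewrite ?oner_neq0 //.
  exact: (eichler0_1 hk).
by rewrite det1 (unitO1 hk).
Qed.

Lemma basemx_unit r t : basemx r t \in unitmx.
Proof. by rewrite mx2_unit mul0r subr0 mul1r (expu_neq0 hpi). Qed.

Lemma conj_by_base r t a b d : conj_by (basemx r t) (mx2 a b 0 d) =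
  let s := pi ^+ (r - t) in let c := b / pi ^+ t in
  mx2 (a - s * c) c (s * (a - d - s * c)) (s * c + d).
Proof.
have p0 := expu_neq0 hpi t.
apply/conj_by_eq; first exact: basemx_unit.
by rewrite !mx2M; congr mx2; field.
Qed.

(** The upper right entry b / pi^t of the conjugate is integral iff b is in pi^t O. Then s c is in
    pi^t O because r - t >= t, so it affects neither the integrality of the diagonal nor the lower
    left condition, which reduces to a - d being in pi^t O. *)
Lemma eichler0_conj_base r t a b d : (2 * t <= r)%N ->
  eichler0 r (conj_by (basemx r t) (mx2 a b 0 d)) <-> upper_pi t (mx2 a b 0 d).
Proof.
move=> tr; rewrite conj_by_base /= eichler0_mx2 (upper_pi_mx2 hk hpi).
set s := pi ^+ (r - t); set c := b / pi ^+ t.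
have E1 : I 0 c <-> I t%:Z b by rewrite /c (val_ideal_divexpu hk hpi) add0r.
have tW (y : k) m : 0 <= m -> I m y -> I 0 y by move=> /val_idealW; apply.
have E2 (y : k) : I r%:Z (s * y) <-> I t%:Z y.
  by rewrite (val_ideal_Mexpu hk hpi); have -> : r%:Z - (r - t)%:Z = t%:Z by lia.
have scT : I 0 c -> I t%:Z (s * c).
  by move=> cO; rewrite (val_ideal_Mexpu hk hpi); apply: val_idealW cO; lia.
have scO : I 0 c -> I 0 (s * c) by move/scT; apply: tW.
split=> [[h1 h2 /E2 h3 h4]|[h1 h2 _ /E1 h3 h4]].
  split => //; last 2 first.
  - exact/E1.
  - by rewrite -[a - d](subrK (s * c)); apply: (val_idealD hk) => //; apply: scT.
  - by rewrite -[a](subrK (s * c)); apply: (val_idealD hk) => //; apply: scO.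
  - rewrite -[d](addKr (s * c)); apply: (val_idealD hk) => //.
    by apply: (val_idealN hk); apply: scO.
split => //.
- by apply: (val_idealB hk) => //; apply: scO.
- by apply/E2; apply: (val_idealB hk) => //; apply: scT.
- by apply: (val_idealD hk) => //; apply: scO.
Qed.

Lemma optimal_conj_base r t : (2 * t <= r)%N ->
  optimal_conj (eichler0 r) (upper_pi t) (basemx r t).
Proof.
move=> tr; split=> [|x]; first exact: basemx_unit.
elim/mx2_ind: x => a b c d; rewrite mx2_10 => ->.
exact: eichler0_conj_base.
Qed.

Lemma conj_by_affmx u w a b d : u != 0 -> conj_by (affmx u w) (mx2 a b 0 d) =
  mx2 a (u * b + w * (d - a)) 0 d.
Proof.
move=> u0; apply/conj_by_eq; first exact: affmx_unit.
by rewrite !mx2M; congr mx2; ring.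
Qed.

Lemma upper_pi_conj_affmx t u w a b d : unitO v u -> I 0 w ->
  upper_pi t (mx2 a b 0 d) <-> upper_pi t (conj_by (affmx u w) (mx2 a b 0 d)).
Proof.
move=> uu wO; have [u0 uO _] := unitOP hk uu.
rewrite conj_by_affmx // !(upper_pi_mx2 hk hpi).
have E : I t%:Z (a - d) ->
    (I t%:Z b <-> I t%:Z (u * b + w * (d - a))).
  move=> ad; have wad : I t%:Z (w * (d - a)).
    by apply: (integersMl hk) => //; rewrite -opprB; apply: (val_idealN hk).
  rewrite -(unitOMl hk t%:Z b uu); split=> h; first exact: (val_idealD hk).
  by rewrite -[u * b](addrK (w * (d - a))); apply: (val_idealB hk).
by split=> -[h1 h2 _ h3 h4]; split => //; apply/(E h4).
Qed.

Lemma optimal_conj_rep r t (b : bool) u w : (2 * t <= r)%N -> unitO v u -> I 0 w ->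
  optimal_conj (eichler0 r) (upper_pi t)
    (swappow r b *m (basemx r t *m affmx u w)).
Proof.
move=> tr uu wO; have [u0 uO _] := unitOP hk uu.
apply: optimal_conj_mull; first exact: Gamma2_swappow.
have [ub bH] := optimal_conj_base tr.
split=> [|x]; first by rewrite unitmx_mul ub affmx_unit.
elim/mx2_ind: x => a b' c d; rewrite mx2_10 => ->.
rewrite conj_byM ?affmx_unit // bH; last by rewrite conj_by_affmx // mx2_10.
by split=> h; apply/(upper_pi_conj_affmx _ _ _ _ uu wO).
Qed.

(** The determinant of a e is a^2 times a unit, so a unit determinant forces the scalar a to be a
    unit. *)
Lemma Gamma1_integral r g : Gamma1 (eichler0 r) g -> unitO v (\det g) ->
  eichler0 r g.
Proof.
move=> [a [e [/eqP a0 ue he heV ->]]]; rewrite detZ => ud.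
have ude := eichler0_det_unit hk ue he heV.
have a2 : unitO v (a ^+ 2).
  have := unitOM hk ud (unitOV hk ude); rewrite mulfK //.
  by have [] := unitOP hk ude.
have [ua0 aO] : a != 0 /\ I 0 a.
  split => //; right; case/andP: a2 => _ /eqP.
  by rewrite expr2 (val_mul hk) //; lia.
move: he; elim/mx2_ind: e {ue heV ud ude} => x y z q.
by rewrite mx2Z !eichler0_mx2 => -[? ? ? ?]; split; apply: (integersMl hk).
Qed.

(** The determinant of the conjugate is the unit u, so the scalar part of K disappears and
    membership in K is integrality, which [eichler0_conj_base] translates into [affmx u w] being in
    H. *)
Lemma Gamma1_conj_base r t u w : (2 * t <= r)%N -> unitO v u ->
  Gamma1 (eichler0 r) (conj_by (basemx r t) (affmx u w)) <->
  I t%:Z w /\ I t%:Z (u - 1).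
Proof.
move=> tr uu; have [u0 uO _] := unitOP hk uu.
have E := eichler0_conj_base u w 1 tr; rewrite (upper_pi_mx2 hk hpi) in E.
have D : \det (conj_by (basemx r t) (affmx u w)) = u.
  rewrite !det_mulmx det_inv mulrAC divff ?mul1r; last first.
    by rewrite -unitfE -unitmxE basemx_unit.
  by rewrite mx2_det mulr1 mulr0 subr0.
split=> [/Gamma1_integral|[wt u1]].
  by rewrite D => /(_ uu) /E[].
rewrite -[conj_by _ _]scale1r; apply: (Gamma1_eichler0 hk); rewrite ?oner_neq0 //.
  by apply/E; split => //; apply: integers1.
by rewrite D.
Qed.

(** By [affmx_div], the quotient of the two affine matrices has entries u'/u and w' - w u'/u. Since
    u is a unit and w is integral, these are 1 and 0 modulo pi^t exactly when both pairs agree. *)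
Lemma rep_congr r t u w u' w' : (2 * t <= r)%N -> unitO v u -> unitO v u' ->
  I 0 w -> (exists2 e, Gamma1 (eichler0 r) e &
    basemx r t *m affmx u' w' = e *m (basemx r t *m affmx u w)) <->
  I t%:Z (u' - u) /\ I t%:Z (w' - w).
Proof.
move=> tr uu uu' wO; have [u0 uO _] := unitOP hk uu.
have ub := basemx_unit r t; have ua := affmx_unit w u0.
have uq : unitO v (u' / u) by apply: (unitOM hk) => //; apply: unitOV.
have <- : Gamma1 (eichler0 r) (conj_by (basemx r t)
    (affmx (u' / u) (w' - w * (u' / u)))) <->
    exists2 e, Gamma1 (eichler0 r) e &
    basemx r t *m affmx u' w' = e *m (basemx r t *m affmx u w).
  rewrite -affmx_div // /conj_by; split=> [Ke|[e Ke eE]].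
    by eexists; first exact: Ke; rewrite !mulmxA !mulmxKV.
  by rewrite mulmxA eE !mulmxA mulmxK // mulmxK.
rewrite Gamma1_conj_base //.
have -> : u' / u - 1 = (u' - u) / u by field.
rewrite (unitOMr hk _ _ (unitOV hk uu)).
have -> : w' - w * (u' / u) = (w' - w) - w * ((u' - u) / u) by field.
have W : I t%:Z (u' - u) -> I t%:Z (w * ((u' - u) / u)).
  by move=> h; apply: (integersMl hk) => //; apply/(unitOMr hk _ _ (unitOV hk uu)).
split=> [[h1 h2]|[h1 h2]]; split => //; last by apply: (val_idealB hk) => //; auto.
by rewrite -[w' - w](subrK (w * ((u' - u) / u))); apply: (val_idealD hk); auto.
Qed.

(** For e = l e', the first rows give l (a pi^(r-t) + b pi^r) = u and l a pi^t = w. As a is a unit,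
    l pi^t is integral, and then pi^(r-2t) divides the unit u. *)
Lemma swap_base_separated r t e u w : Gamma1 (eichler0 r) e -> unitO v u ->
  I 0 w -> (2 * t < r)%N ->
  e *m (swapmx r *m basemx r t) = basemx r t *m affmx u w -> False.
Proof.
move=> [l [e' [/eqP l0 ue he heV ->]]] uu wO tr.
have := eichler0_det_unit hk ue he heV.
move: he; elim/mx2_ind: e' {ue heV} => a b c d.
rewrite eichler0_mx2 mx2_det => -[aO bO cr dO] ud.
rewrite -scalemxAl !mx2M mx2Z => /mx2_inj[].
rewrite !(mulr0, mul0r, mulr1, addr0, mul1r, add0r) => E1 E2 _ _.
(* The entry c is divisible by pi^r with r > 0, so a d is congruent to the unit determinant modulo
   pi. *)
have ua : unitO v a.
  have : unitO v (a * d).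
    apply: (unitO_congr hk ud).
    rewrite addrC addKr; apply: (val_idealN hk).
    by apply: (integersMl hk) => //; apply: val_idealW cr; lia.
  move=> /(unitOP hk)[ad0 _ adV]; move: ad0; rewrite mulf_eq0 negb_or.
  case/andP=> a0 d0; apply: (unitO_intro hk) => //.
  have -> : a^-1 = d * (a * d)^-1 by rewrite invfM mulrCA mulfV // mulr1.
  exact: (integersMl hk).
have [a0 _ _] := unitOP hk ua.
have lq : I 0 (l * pi ^+ t).
  by apply/(unitOMl hk _ _ ua); rewrite mulrCA E2.
have [] : ~ I 1 u by apply: unitO_val_ideal1.
rewrite -E1.
have -> : pi ^+ r = pi ^+ (r - 2 * t) * pi ^+ t * pi ^+ t.
  by rewrite -!exprD; congr (_ ^+ _); lia.
have -> : pi ^+ (r - t) = pi ^+ (r - 2 * t) * pi ^+ t.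
  by rewrite -exprD; congr (_ ^+ _); lia.
have -> : l * (a * (pi ^+ (r - 2 * t) * pi ^+ t) +
    b * (pi ^+ (r - 2 * t) * pi ^+ t * pi ^+ t)) =
  (l * pi ^+ t) * (a + b * pi ^+ t) * pi ^+ (r - 2 * t) by ring.
apply: (val_idealW (n := 0 + (r - 2 * t)%:Z)); first lia.
have pO n : I 0 (pi ^+ n) by apply/(val_ideal_expu hk hpi).
apply: (val_idealM hk); last by apply/(val_ideal_expu hk hpi).
apply: (integersMl hk) => //; apply: (val_idealD hk) => //.
exact: (integersMl hk).
Qed.

Lemma swap_rep_separated r t e u w u' w' : Gamma1 (eichler0 r) e ->
  unitO v u -> unitO v u' -> I 0 w -> I 0 w' -> (2 * t < r)%N ->
  e *m (swapmx r *m (basemx r t *m affmx u w)) = basemx r t *m affmx u' w' ->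
  False.
Proof.
move=> Ke uu uu' wO wO' tr E; have [u0 uO uV] := unitOP hk uu.
have uq : unitO v (u' / u) by apply: (unitOM hk) => //; apply: unitOV.
apply: (@swap_base_separated r t e (u' / u) (w' - w * (u' / u))) => //.
  by apply: (val_idealB hk) => //; apply: (integersMl hk); case: (unitOP hk uq).
rewrite -affmx_div // [RHS]mulmxA -E -!mulmxA mulmxV ?mulmx1 //.
exact: affmx_unit.
Qed.

Lemma swap_base t : swapmx (2 * t) *m basemx (2 * t) t =
  (- pi ^+ t) *: (basemx (2 * t) t *m affmx (-1) (-1)).
Proof.
rewrite !mx2M mx2Z (_ : (2 * t - t = t)%N); last by lia.
by rewrite mul2n -addnn exprD; congr mx2; ring.
Qed.

Lemma affmxM u w u' w' : affmx u w *m affmx u' w' = affmx (u * u') (u * w' + w).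
Proof. by rewrite mx2M; congr mx2; ring. Qed.

(* An element normalizing E_r is an optimal conjugator for t = 0. *)
Lemma Gamma2_eichler0 r g : Gamma2 (eichler0 r) g ->
  exists2 e, Gamma1 (eichler0 r) e & exists b : bool, g = e *m swappow r b.
Proof.
move=> Gg; have P1 : optimal_conj (eichler0 r) (upper_pi 0) 1%:M.
  split=> [|x]; first exact: unitmx1.
  elim/mx2_ind: x => a b c d; rewrite mx2_10 conj_by1 => ->.
  rewrite eichler0_mx2 (upper_pi_mx2 hk hpi); split=> [[? ? _ ?]|[? ? _ ? _]].
    by split => //; apply: (val_idealB hk).
  by split => //; left.
have [_ [e [b [u [w [Ke uu wO E]]]]]] :=
  optimal_conj_classify hk hpi (optimal_conj_mull Gg P1).
rewrite mulmx1 in E; set n := basemx r 0 *m affmx u w in E.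
have [u0 uO _] := unitOP hk uu.
(* For t = 0 the matrix Z and the affine factor are both integral with unit determinant. *)
have Kn : Gamma1 (eichler0 r) n.
  rewrite -[n]scale1r; apply: (Gamma1_eichler0 hk); rewrite ?oner_neq0 //.
    apply: (eichler0_mul hk); rewrite eichler0_mx2 ?subn0; split.
    all: try exact: integers1; try exact: val_ideal0; try done.
    by apply/(val_ideal_expu hk hpi).
  by rewrite det_mulmx !mx2_det subn0 expr0 !(mulr0, mulr1, subr0, mul0r, mul1r).
exists (e *m conj_by (swappow r b) n).
  apply: Gamma1_mul => //; first exact: eichler0_mul.
  by apply: Gamma1_conj => //; apply: Gamma2_swappow.
exists b; rewrite E; clearbody n; rewrite -mulmxA; congr (_ *m _).
rewrite /conj_by mulmxKV //.
by case/Gamma2P: (Gamma2_swappow r b).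
Qed.

(** Images of two elements of H suffice: pi^t e12 forces c = 0 and then, read in both directions,
    that a / d is a unit, while pi^t e22 forces b / d to be integral. *)
Lemma normalizer_upper_pi t (n : M2) : n \in unitmx ->
  conj_by n @` (upper_pi t) = upper_pi t ->
  exists a u w, [/\ a != 0, unitO v u, I 0 w & n = a *: affmx u w].
Proof.
move=> un /(image_conj_byP _ _ un) h.
have p0 := expu_neq0 hpi t.
have O0 m := val_ideal0 v m.
have pt : I t%:Z (pi ^+ t) by apply/(val_ideal_expu hk hpi).
have pO : I 0 (pi ^+ t) by apply: val_idealW pt; lia.
have H12 : upper_pi t (mx2 0 (pi ^+ t) 0 0).
  by rewrite (upper_pi_mx2 hk hpi) subr0; split.
have H22 : upper_pi t (mx2 0 0 0 (pi ^+ t)).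
  rewrite (upper_pi_mx2 hk hpi) sub0r; split => //.
  exact: (val_idealN hk).
move: un h; elim/mx2_ind: n => a b c d un h.
have D0 : a * d - b * c != 0 by rewrite -mx2_unit.
(* The lower left entry of the conjugate of pi^t e12 is -c^2 pi^t divided by the determinant. *)
have c0 : c = 0.
  move: ((h _).1 H12); rewrite /conj_by mx2V // -scalemxAr !mx2M mx2Z.
  rewrite (upper_pi_mx2 hk hpi) => -[_ _ E _ _].
  have /eqP : c * c * pi ^+ t = 0.
    by apply: (mulIf (invr_neq0 D0)); rewrite mul0r -[RHS]oppr0 -E; field.
  by rewrite mulf_eq0 (negbTE p0) orbF mulf_eq0 orbb => /eqP.
rewrite c0 mulr0 subr0 in D0 h un *.
have [a0 d0] : a != 0 /\ d != 0 by apply/andP; rewrite -negb_or -mulf_eq0.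
have nE : mx2 a b 0 d = d *: affmx (a / d) (b / d).
  by rewrite mx2Z; congr mx2; field.
have u0 : a / d != 0 by rewrite mulf_neq0 ?invr_eq0.
have divpt (x : k) : I t%:Z (x * pi ^+ t) -> I 0 x.
  by rewrite mulrC (val_ideal_Mexpu hk hpi) subrr.
have hE (x y z : k) : upper_pi t (mx2 x y 0 z) <->
    upper_pi t (mx2 x (a / d * y + b / d * (z - x)) 0 z).
  by rewrite (h (mx2 x y 0 z)) nE conj_byZ ?affmx_unit // conj_by_affmx.
exists d, (a / d), (b / d); split => //.
  apply: (unitO_intro hk) => //.
    move: ((hE _ _ _).1 H12); rewrite (upper_pi_mx2 hk hpi) => -[_ _ _ + _].
    by rewrite subr0 mulr0 addr0 => /divpt.
  move: (hE 0 ((a / d)^-1 * pi ^+ t) 0); rewrite subr0 mulr0 addr0.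
  rewrite mulrA mulfV // mul1r => -[_ /(_ H12)].
  by rewrite (upper_pi_mx2 hk hpi) => -[_ _ _ /divpt].
move: ((hE _ _ _).1 H22); rewrite (upper_pi_mx2 hk hpi) => -[_ _ _ + _].
by rewrite subr0 mulr0 add0r => /divpt.
Qed.

End Representatives.

(** * Eichler orders in standard form *)

Section LinSpan.
Variables (k : fieldType) (V : lmodType k) (S : set k).
Implicit Types (A B : set V) (x y : V).

Lemma lin_spanD A x y : lin_span S A x -> lin_span S A y -> lin_span S A (x + y).
Proof.
move=> [m [c [p [cS pA ->]]]] [n [d [q [dS qA ->]]]].
exists (m + n)%N.
exists (fun i => match fintype.split i with inl j => c j | inr j => d j end).
exists (fun i => match fintype.split i with inl j => p j | inr j => q j end).
split=> [i|i|]; try by case: fintype.split.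
rewrite big_split_ord /=; congr (_ + _); apply: eq_bigr => i _.
  by rewrite (unsplitK (inl i)).
by rewrite (unsplitK (inr i)).
Qed.

Lemma lin_spanZ A a x : (forall b, S b -> S (a * b)) ->
  lin_span S A x -> lin_span S A (a *: x).
Proof.
move=> aS [m [c [p [cS pA ->]]]]; exists m, (fun i => a * c i), p.
split=> // [i|]; first exact: aS.
by rewrite scaler_sumr; apply: eq_bigr => i _; rewrite scalerA.
Qed.

Lemma lin_span_scale A a x : S a -> A x -> lin_span S A (a *: x).
Proof.
move=> Sa Ax; exists 1%N, (fun=> a), (fun=> x); split=> //.
by rewrite big_ord1.
Qed.

Lemma lin_span_sub A B : B 0 -> (forall x y, B x -> B y -> B (x + y)) ->
  (forall a x, S a -> A x -> B (a *: x)) -> lin_span S A `<=` B.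
Proof.
move=> B0 BD BZ x [m [c [p [cS pA ->]]]].
by elim/big_ind: _ => // i _; apply: BZ.
Qed.

End LinSpan.

(** * Maximal orders, Smith normal form and the level *)

Section EichlerStandard.
Variables (k : fieldType) (v : k -> int).
Hypothesis hk : local_field v.
Variable pi : k.
Hypothesis hpi : uniformizer v pi.
Local Notation I := (val_ideal v).
Local Notation M2 := 'M[k]_2.
Local Notation eichler0 := (eichler0 v).
Local Notation upper_pi := (upper_pi v pi).

Lemma lin_span_conj (S : set k) (g : M2) (A : set M2) : g \in unitmx ->
  lin_span S (conj_by g @` A) = conj_by g @` lin_span S A.
Proof.
move=> ug; apply/seteqP; split=> x.
  move=> [m [c [p [cS pA ->]]]].
  exists (\sum_i c i *: conj_by (invmx g) (p i)).
    exists m, c, (conj_by (invmx g) \o p); split=> // i /=.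
    by have [y Ay <-] := pA i; rewrite conj_byK.
  rewrite /conj_by mulmx_sumr mulmx_suml; apply: eq_bigr => i _.
  by rewrite -/(conj_by _ _) -/(conj_by g _) conj_by_scale conj_byVK.
move=> [_ [m [c [p [cS pA ->]]]] <-]; exists m, c, (conj_by g \o p).
split=> [//|i|]; first by exists (p i).
rewrite /conj_by mulmx_sumr mulmx_suml; apply: eq_bigr => i _ /=.
exact: conj_by_scale.
Qed.

Lemma is_order_conj (g : M2) (A : set M2) : g \in unitmx -> is_order v A ->
  is_order v (conj_by g @` A).
Proof.
move=> ug [A1 AM [s As]]; split.
- by exists 1%:M => //; rewrite conj_by_one.
- move=> _ _ [x Ax <-] [y Ay <-]; exists (x *m y); first exact: AM.
  exact: conj_by_mul.
exists (map (conj_by g) s); rewrite As -lin_span_conj //; congr lin_span.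
apply/seteqP; split=> [_ [x xs <-]|_ /mapP[x xs ->]]; last by exists x.
exact: map_f.
Qed.

(** Valuations are integers, so when they are bounded below the least one is attained. This supplies
    generators of fractional ideals and pivots for elimination. *)
Lemma val_ideal_wo (P : set k) : (exists2 x, P x & x != 0) ->
  (exists N : nat, forall x, P x -> I (- N%:Z) x) ->
  exists2 x, P x & x != 0 /\ forall y, P y -> I 0 (y / x).
Proof.
move=> [x0 Px0 x00] [N PN].
pose Q (n : nat) := `[< exists x, [/\ P x, x != 0 & v x = n%:Z - N%:Z] >].
have nat_of x : P x -> x != 0 -> v x = (absz (v x + N%:Z))%:Z - N%:Z.
  by move=> Px x1; have /(val_ideal_nz x1) := PN _ Px; lia.
have exQ : exists n, Q n.
  exists (absz (v x0 + N%:Z)); apply/asboolP; exists x0; split=> //.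
  exact: nat_of.
case: (ex_minnP exQ) => n /asboolP[x [Px x1 xn]] minn; exists x => //.
split=> // y Py; have [->|y1] := eqVneq y 0; first by rewrite mul0r; left.
right; rewrite (val_mul hk) ?invr_eq0 // (valV hk) //.
have /minn : Q (absz (v y + N%:Z)).
  by apply/asboolP; exists y; split=> //; apply: nat_of.
have := nat_of _ Py y1; lia.
Qed.

Lemma eichler0_0P (x : M2) : eichler0 0 x <-> forall i j, I 0 (x i j).
Proof.
split=> [[h1 h2 h3 h4] i j|h]; last by split; apply: h.
by case: (ord2_cases i) => ->; case: (ord2_cases j) => ->.
Qed.

Lemma is_order_eichler0 : is_order v (eichler0 0).
Proof.
split; first exact: (eichler0_1 hk).
  by move=> x y; apply: (eichler0_mul hk).
exists [:: mx2 1 0 0 0; mx2 0 1 0 0; mx2 0 0 1 0; mx2 0 0 0 1].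
have O0 := val_ideal0 v 0; have O1 := integers1 hk.
apply/seteqP; split=> [x|].
  elim/mx2_ind: x => a b c d; rewrite eichler0_mx2 => -[ha hb hc hd].
  have -> : mx2 a b c d = a *: mx2 1 0 0 0 + b *: mx2 0 1 0 0 +
      c *: mx2 0 0 1 0 + d *: mx2 0 0 0 1.
    by rewrite !mx2Z !mx2D; congr mx2; ring.
  by do ![apply: lin_spanD | apply: lin_span_scale] => //=;
     rewrite !inE eqxx ?orbT.
apply: lin_span_sub.
- by rewrite mx2_0 eichler0_mx2.
- move=> x y /eichler0_0P h1 /eichler0_0P h2; apply/eichler0_0P => i j.
  by rewrite mxE; apply: (val_idealD hk).
move=> a x aO /= xs; apply/eichler0_0P => i j; rewrite mxE.
apply: (integersMl hk) => //; move: i j; apply/eichler0_0P; move: xs.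
by rewrite !inE => /or4P[] /eqP ->; rewrite eichler0_mx2.
Qed.

Lemma is_order_upper_pi t : is_order v (upper_pi t).
Proof.
have O0 n := val_ideal0 v n; have O1 := integers1 hk.
have pt : I t%:Z (pi ^+ t) by apply/(val_ideal_expu hk hpi).
have tO x : I t%:Z x -> I 0 x by apply: val_idealW; lia.
split.
- by rewrite mx2_scalar (upper_pi_mx2 hk hpi) subrr.
- move=> x y; elim/mx2_ind: x => a b c d; elim/mx2_ind: y => a' b' c' d'.
  rewrite mx2M !(upper_pi_mx2 hk hpi) => -[ha hd -> hb had] [ha' hd' -> hb' had'].
  rewrite !(mulr0, mul0r, addr0, add0r); split => //.
  + exact: (integersMl hk).
  + exact: (integersMl hk).
  + apply: (val_idealD hk); first exact: (integersMl hk).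
    exact: (integersMr hk).
  have -> : a * a' - d * d' = a * (a' - d') + (a - d) * d' by ring.
  apply: (val_idealD hk); first exact: (integersMl hk).
  exact: (integersMr hk).
exists [:: mx2 1 0 0 1; mx2 (pi ^+ t) 0 0 0; mx2 0 (pi ^+ t) 0 0].
apply/seteqP; split=> [x|].
  elim/mx2_ind: x => a b c d; rewrite (upper_pi_mx2 hk hpi) => -[ha hd -> hb had].
  have [b' hb' ->] := val_ideal_factor hk hpi hb.
  have [e he E] := val_ideal_factor hk hpi had.
  have -> : mx2 a (pi ^+ t * b') 0 d = d *: mx2 1 0 0 1 + e *: mx2 (pi ^+ t) 0 0 0 +
      b' *: mx2 0 (pi ^+ t) 0 0.
    by rewrite !mx2Z !mx2D -[a](subrK d) E; congr mx2; ring.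
  by do ![apply: lin_spanD | apply: lin_span_scale] => //=;
     rewrite !inE eqxx ?orbT.
apply: lin_span_sub.
- by rewrite mx2_0 (upper_pi_mx2 hk hpi) subrr.
- move=> x y; elim/mx2_ind: x => a b c d; elim/mx2_ind: y => a' b' c' d'.
  rewrite mx2D !(upper_pi_mx2 hk hpi) => -[ha hd -> hb had] [ha' hd' -> hb' had'].
  split; rewrite ?addr0 //; try exact: (val_idealD hk).
  have -> : a + a' - (d + d') = (a - d) + (a' - d') by ring.
  exact: (val_idealD hk).
move=> a x aO /=; rewrite !inE => /or3P[] /eqP ->;
  rewrite mx2Z (upper_pi_mx2 hk hpi) ?mulr0 ?subrr ?mulr1 ?subr0;
  split=> //; try exact: (integersMl hk).
exact/tO/(integersMl hk).
Qed.

(* The first columns of the elements of D form a lattice stable under D; the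
   columns of h are a basis of it in triangular form. *)
Lemma maximal_order_conj (D : set M2) : maximal_order v D ->
  exists2 h, h \in unitmx & D = conj_by h @` eichler0 0.
Proof.
move=> [[D1 DM [s Ds]] Dspan Dmax].
have O0 n := val_ideal0 v n.
have DD x y : D x -> D y -> D (x + y) by rewrite Ds; apply: lin_spanD.
have DZ (a : k) x : I 0 a -> D x -> D (a *: x).
  by move=> aO; rewrite Ds; apply: lin_spanZ => b; apply: (integersMl hk).
(* Finitely many generators give a common bound on the denominators of the entries of D. *)
have [N DN] : exists N : nat, forall x, D x -> forall i j, I (- N%:Z) (x i j).
  have large (x : k) : exists n : nat, I (- n%:Z) x.
    by exists `|v x|%N; right; lia.
  have [N sN] : exists N : nat,
      forall x, x \in s -> forall i j, I (- N%:Z) (x i j).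
    elim: s {Ds} => [|y s [N sN]]; first by exists 0%N.
    have [n1 h1] := large (y 0 0); have [n2 h2] := large (y 0 1).
    have [n3 h3] := large (y 1 0); have [n4 h4] := large (y 1 1).
    exists (N + n1 + n2 + n3 + n4)%N => x; rewrite inE => /orP[/eqP ->|/sN h] i j.
      case: (ord2_cases i) => ->; case: (ord2_cases j) => ->.
      - by apply: val_idealW h1; lia.
      - by apply: val_idealW h2; lia.
      - by apply: val_idealW h3; lia.
      - by apply: val_idealW h4; lia.
    by apply: val_idealW (h i j); lia.
  exists N => x; rewrite Ds; move: x; apply: lin_span_sub.
  - by move=> i j; rewrite mxE.
  - by move=> x y hx hy i j; rewrite mxE; apply: (val_idealD hk).
  - by move=> a x aO xs i j; rewrite mxE; apply: (integersMl hk) => //; apply: sN.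
have Dfull (x : M2) : exists M : nat, D (pi ^+ M *: x).
  have : kspan D x by rewrite Dspan.
  move: x; apply: lin_span_sub.
  - exists 0%N; rewrite scaler0 -[0](scale0r 1%:M); exact: DZ.
  - have W n m x : (n <= m)%N -> D (pi ^+ n *: x) -> D (pi ^+ m *: x).
      move=> nm h; rewrite -(subnK nm) exprD -scalerA; apply: DZ => //.
      by apply/(val_ideal_expu hk hpi).
    move=> x y [m hm] [n hn]; exists (m + n)%N; rewrite scalerDr.
    by apply: DD; [apply: W hm|apply: W hn]; lia.
  move=> a x _ Dx; have [n an] := val_large hk hpi a.
  by exists n; rewrite scalerA; apply: DZ.
(* [L1] collects the bottom entries of the first columns of D, and [L0] the top entries of those
   columns whose bottom entry is 0. Generators of these fractional ideals give the triangular basis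
   (a0, 0), (a1, b1). *)
pose L1 : set k := [set b | exists2 x, D x & b = x 1 0].
pose L0 : set k := [set a | exists2 x, D x & a = x 0 0 /\ x 1 0 = 0].
have [b1 [x1 Dx1 b1E] [b10 b1min]] :
    exists2 x, L1 x & x != 0 /\ forall y, L1 y -> I 0 (y / x).
  apply: val_ideal_wo; last by exists N => _ [x Dx ->]; apply: DN.
  have [M] := Dfull (mx2 0 0 1 0); rewrite mx2Z => DM1.
  exists (pi ^+ M); last exact: (expu_neq0 hpi).
  by eexists; first exact: DM1; rewrite mx2E mulr1.
have [a0 [x0 Dx0 [a0E x010]] [a00 a0min]] :
    exists2 x, L0 x & x != 0 /\ forall y, L0 y -> I 0 (y / x).
  apply: val_ideal_wo; last by exists N => _ [x Dx [-> _]]; apply: DN.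
  have [M] := Dfull (mx2 1 0 0 0); rewrite mx2Z => DM0.
  exists (pi ^+ M); last exact: (expu_neq0 hpi).
  by eexists; first exact: DM0; rewrite !mx2E mulr1 mulr0.
set a1 := x1 0 0; pose h := mx2 a0 a1 0 b1.
have uh : h \in unitmx by rewrite mx2_unit mulr0 subr0 mulf_neq0.
have col x : D x -> exists al be : k,
    [/\ I 0 al, I 0 be, x 0 0 = al * a0 + be * a1 & x 1 0 = be * b1].
  move=> Dx; set be := x 1 0 / b1.
  have beO : I 0 be by apply: b1min; exists x.
  exists ((x 0 0 - be * a1) / a0), be; split => //; last by rewrite divfK.
    apply: a0min; exists (x + (- be) *: x1).
      by apply: DD => //; apply: DZ => //; apply: (val_idealN hk).
    by rewrite !mxE -b1E !mulNr divfK // subrr.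
  by rewrite divfK // subrK.
(* The columns of d h are the first columns of d x0 and d x1, which lie in D; their coordinates in
   the basis h form an integral matrix. *)
have DE : D `<=` conj_by h @` eichler0 0.
  move=> d Dd; apply/image_conj_by => //.
  have [al [be [alO beO e1 e2]]] := col _ (DM _ _ Dd Dx0).
  have [al' [be' [alO' beO' e1' e2']]] := col _ (DM _ _ Dd Dx1).
  have -> : conj_by (invmx h) d = mx2 al al' be be'.
    apply/conj_by_eq; first by rewrite unitmx_inv.
    apply: (canLR (mulKmx uh)); rewrite mulmxA; apply: (canRL (mulmxK uh)).
    move: e1 e2 e1' e2'.
    rewrite [d]mx2_eta [x0]mx2_eta [x1]mx2_eta !mx2M !mx2E.
    rewrite -a0E x010 -b1E -/a1 !mulr0 !addr0 => -> -> -> ->.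
    by congr mx2; ring.
  by rewrite eichler0_mx2.
exists h => //; rewrite (Dmax _ _ DE) //; apply: is_order_conj => //.
exact: is_order_eichler0.
Qed.

(** Elimination with a pivot of least valuation, brought to the upper left corner by J. The pivot
    goes into e as a scalar, which is why the first diagonal entry is 1. *)
Lemma cartan (g : M2) : g \in unitmx -> exists e e' s,
  [/\ Gamma1 (eichler0 0) e, Gamma1 (eichler0 0) e' &
      g = e *m mx2 1 0 0 (pi ^+ s) *m e'].
Proof.
have O0 n := val_ideal0 v n; have O1 := integers1 hk.
have K1 (e : M2) : eichler0 0 e -> unitO v (\det e) -> Gamma1 (eichler0 0) e.
  move=> he ue; rewrite -[e]scale1r; apply: (Gamma1_eichler0 hk) => //.
  exact: oner_neq0.
have main x y z w : mx2 x y z w \in unitmx -> x != 0 -> I 0 (y / x) ->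
    I 0 (z / x) -> I 0 (w / x) -> exists e e' s,
    [/\ Gamma1 (eichler0 0) e, Gamma1 (eichler0 0) e' &
      mx2 x y z w = e *m mx2 1 0 0 (pi ^+ s) *m e'].
  (* This q is the determinant divided by x^2, that is, the entry left after clearing the first row
     and column of the matrix divided by x. *)
  move=> ug x0 hy hz hw; set q := w / x - z / x * (y / x).
  have qO : I 0 q by apply: (val_idealB hk) => //; apply: (integersMl hk).
  have q0 : q != 0.
    move: ug; rewrite mx2_unit; apply: contra => /eqP q0; apply/eqP.
    transitivity (x * x * q); last by rewrite q0 mulr0.
    by rewrite /q; field.
  have [s sE] : exists s : nat, v q = s%:Z.
    by move: (val_ideal_nz q0 qO); case: (v q) => // n _; exists n.
  have p0 := expu_neq0 hpi s.
  set u := q / pi ^+ s.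
  have uu : unitO v u.
    rewrite /unitO mulf_neq0 ?invr_eq0 //= (val_mul hk) ?invr_eq0 //.
    by rewrite (valV hk) // (valX hk hpi) sE; apply/eqP; lia.
  have [u0 uO _] := unitOP hk uu.
  exists (x *: mx2 1 0 (z / x) 1), (mx2 1 (y / x) 0 u), s; split.
  - apply: Gamma1Z => //; apply: K1; first by rewrite eichler0_mx2.
    by rewrite mx2_det mul0r subr0 mulr1 unitO1.
  - apply: K1; first by rewrite eichler0_mx2.
    by rewrite mx2_det mulr0 subr0 mul1r.
  rewrite -!scalemxAl !mx2M mx2Z /u /q; congr mx2; field; rewrite ?x0 ?p0 //.
pose J := mx2 0 1 1 0 : M2.
have KJ : Gamma1 (eichler0 0) J.
  apply: K1; first by rewrite eichler0_mx2.
  by rewrite mx2_det mul0r sub0r mulr1; apply: (unitON hk); apply: unitO1.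
have JJ : J *m J = 1%:M by rewrite mx2M mx2_scalar; congr mx2; ring.
have uJ := Gamma1_unitmx KJ.
have KM := Gamma1_mul (@eichler0_mul _ _ hk 0).
have Jl g' : (exists e e' s, [/\ Gamma1 (eichler0 0) e, Gamma1 (eichler0 0) e' &
    J *m g' = e *m mx2 1 0 0 (pi ^+ s) *m e']) -> exists e e' s,
    [/\ Gamma1 (eichler0 0) e, Gamma1 (eichler0 0) e' &
      g' = e *m mx2 1 0 0 (pi ^+ s) *m e'].
  move=> [e [e' [s [Ke Ke' E]]]]; exists (J *m e), e', s; split => //.
    exact: KM.
  by rewrite -[LHS]mul1mx -JJ -mulmxA E !mulmxA.
have Jr g' : (exists e e' s, [/\ Gamma1 (eichler0 0) e, Gamma1 (eichler0 0) e' &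
    g' *m J = e *m mx2 1 0 0 (pi ^+ s) *m e']) -> exists e e' s,
    [/\ Gamma1 (eichler0 0) e, Gamma1 (eichler0 0) e' &
      g' = e *m mx2 1 0 0 (pi ^+ s) *m e'].
  move=> [e [e' [s [Ke Ke' E]]]]; exists e, (e' *m J), s; split => //.
    exact: KM.
  by rewrite mulmxA -E -mulmxA JJ mulmx1.
elim/mx2_ind: g => x y z w ug.
have [m mP [m0 mmin]] : exists2 m,
    [set m | [\/ m = x, m = y, m = z | m = w]] m &
    m != 0 /\ forall y0, [set m | [\/ m = x, m = y, m = z | m = w]] y0 ->
    I 0 (y0 / m).
  apply: val_ideal_wo.
    apply: contrapT => h.
    have hz m : [\/ m = x, m = y, m = z | m = w] -> m = 0.
      by move=> hm; apply/eqP; apply: contrapT => /negP m0; apply: h; exists m.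
    have x0 : x = 0 by apply: hz; apply: Or41.
    have y0 : y = 0 by apply: hz; apply: Or42.
    by move: ug; rewrite mx2_unit x0 y0 !mul0r subrr eqxx.
  exists (`|v x| + `|v y| + `|v z| + `|v w|)%N.
  by move=> m [] ->; right; lia.
have hx := mmin x (Or41 _ _ _ erefl); have hy := mmin y (Or42 _ _ _ erefl).
have hz := mmin z (Or43 _ _ _ erefl); have hw := mmin w (Or44 _ _ _ erefl).
have gJ a b c d : mx2 a b c d *m J = mx2 b a d c by rewrite mx2M; congr mx2; ring.
have Jg a b c d : J *m mx2 a b c d = mx2 c d a b by rewrite mx2M; congr mx2; ring.
have ugJ (a b c d : k) : mx2 a b c d \in unitmx -> mx2 b a d c \in unitmx.
  by move=> hu; rewrite -(gJ a b c d) unitmx_mul hu.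
have uJg (a b c d : k) : mx2 a b c d \in unitmx -> mx2 c d a b \in unitmx.
  by move=> hu; rewrite -(Jg a b c d) unitmx_mul uJ.
case: mP => mE; rewrite mE in m0 hx hy hz hw.
- exact: main.
- by apply: Jr; rewrite gJ; apply: main => //; apply: ugJ.
- by apply: Jl; rewrite Jg; apply: main => //; apply: uJg.
- by apply: Jl; rewrite Jg; apply: Jr; rewrite gJ; apply: main => //;
    apply: ugJ; apply: uJg.
Qed.

(* The level is the least n such that pi^n annihilates the quotient. *)
Lemma quotient_iso_level h r s : h \in unitmx ->
  quotient_iso (integers v) (conj_by h @` eichler0 0) (conj_by h @` eichler0 s)
    (integers v : set k^o) (pow_ideal v pi r) -> r = s.
Proof.
move=> uh [f [fO _ fZ fE fS]].
have O0 n := val_ideal0 v n; have O1 := integers1 hk.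
have pO n : I 0 (pi ^+ n) by apply/(val_ideal_expu hk hpi).
have powE (x : k) : pow_ideal v pi r x <-> I r%:Z x.
  split=> [[a aO <-]|]; first by rewrite (val_ideal_Mexpu hk hpi) subrr.
  by move=> /(val_ideal_factor hk hpi)[y yO ->]; exists y.
have hE n x : (conj_by h @` eichler0 n) (conj_by h x) <-> eichler0 n x.
  by rewrite image_conj_by // conj_byK.
apply/eqP; rewrite eqn_leq; apply/andP; split.
  (* An element mapped to the class of 1 is multiplied into E by pi^s, so pi^s is in pi^r O. *)
  have [x [y yO <-]] := fS 1 O1; set x' := conj_by h y => /powE h1.
  have Dx : (conj_by h @` eichler0 0) x' by exists y.
  have Ex : (conj_by h @` eichler0 s) (pi ^+ s *: x').
    rewrite -conj_by_scale hE; move: yO {h1 Dx x'}; elim/mx2_ind: y => a b c d.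
    rewrite mx2Z !eichler0_mx2 => -[ha hb hc hd].
    split; try by apply: (integersMl hk).
    by rewrite (val_ideal_Mexpu hk hpi) subrr.
  have Dx' : (conj_by h @` eichler0 0) (pi ^+ s *: x').
    rewrite -conj_by_scale hE; apply/eichler0_0P => i j; rewrite mxE.
    by apply: (integersMl hk) => //; move: i j; apply/eichler0_0P.
  have /powE h2 := (fE _ Dx').2 Ex.
  have /powE h3 := fZ _ _ (pO s) Dx.
  have h4 : I r%:Z (pi ^+ s * f x').
    have -> : pi ^+ s * f x' = f (pi ^+ s *: x') - (f (pi ^+ s *: x') - pi ^+ s *: f x').
      by rewrite opprB addrC subrK.
    exact: (val_idealB hk).
  have : I r%:Z (pi ^+ s); last by move/(val_ideal_expu hk hpi).
  have -> : pi ^+ s = pi ^+ s * (1 - f x') + pi ^+ s * f x'.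
    by rewrite mulrBr mulr1 subrK.
  by apply: (val_idealD hk) => //; apply: (integersMl hk).
(* The class of e21 generates the quotient; multiplied by pi^r it maps to 0, hence pi^r e21 is in
   E_s and s <= r. *)
pose y : M2 := mx2 0 0 1 0; have yO : eichler0 0 y by rewrite eichler0_mx2.
have Dx : (conj_by h @` eichler0 0) (conj_by h y) by exists y.
have Dx' : (conj_by h @` eichler0 0) (pi ^+ r *: conj_by h y).
  rewrite -conj_by_scale hE; apply/eichler0_0P => i j; rewrite mxE.
  by apply: (integersMl hk) => //; move: i j; apply/eichler0_0P.
have /powE h3 := fZ _ _ (pO r) Dx.
have h2 : I r%:Z (f (pi ^+ r *: conj_by h y)).
  rewrite -[f _](subrK (pi ^+ r *: f (conj_by h y))).
  apply: (val_idealD hk) => //.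
  by apply/(val_ideal_Mexpu hk hpi); rewrite subrr; apply: fO.
move/powE: h2 => /(fE _ Dx').1; rewrite -conj_by_scale hE mx2Z eichler0_mx2.
by move=> [_ _ + _]; rewrite mulr1 => /(val_ideal_expu hk hpi).
Qed.

(** Write the maximal orders as conjugates of M_2(O) by h1 and h2, and decompose h1^-1 h2 = e dl e'.
    The outer factors stabilize M_2(O), so after conjugation by h = h1 e the two orders become
    M_2(O) and its conjugate by dl = diag(1, pi^s). These meet in E_s, and the quotient modules
    identify s with r. *)
Lemma eichler_order_conj r (E : set M2) : eichler_order v pi r E ->
  exists2 h, h \in unitmx & E = conj_by h @` eichler0 r.
Proof.
move=> [D1 [D2 [/maximal_order_conj[h1 uh1 D1E] /maximal_order_conj[h2 uh2 D2E] EE q _]]].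
have ug : invmx h1 *m h2 \in unitmx by rewrite unitmx_mul unitmx_inv uh1.
have [e [e' [s [Ke Ke' gE]]]] := cartan ug.
have ue := Gamma1_unitmx Ke.
have G2 g : Gamma1 (eichler0 0) g -> Gamma2 (eichler0 0) g.
  by apply: Gamma1_sub; apply: eichler0_mul.
set dl := mx2 1 0 0 (pi ^+ s) in gE.
have p0 := expu_neq0 hpi s.
have ud : dl \in unitmx by rewrite mx2_unit mul0r subr0 mul1r.
pose h := h1 *m e; have uh : h \in unitmx by rewrite unitmx_mul uh1.
have h2E : h2 = h *m dl *m e' by rewrite /h -!mulmxA mulmxA in gE *;
  rewrite -[LHS](mulKVmx uh1) gE !mulmxA.
have stab g g' x : g \in unitmx -> Gamma2 (eichler0 0) g' ->
    (conj_by (g *m g') @` eichler0 0) x <-> eichler0 0 (conj_by (invmx g) x).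
  move=> ug' /Gamma2_inv /Gamma2P[ug2 hg]; rewrite unitmx_inv in ug2.
  rewrite image_conj_by ?unitmx_mul ?ug' // invmxM // conj_byM ?unitmx_inv //.
  exact: iff_sym (hg _).
have D1x x : D1 x <-> eichler0 0 (conj_by (invmx h) x).
  by rewrite D1E -(stab _ (invmx e)) // /h; [rewrite mulmxK|apply/Gamma2_inv/G2].
have D2x x : D2 x <-> eichler0 0 (conj_by (invmx (h *m dl)) x).
  rewrite D2E h2E; apply: stab; last exact: G2.
  by rewrite unitmx_mul uh.
have Ex : E = conj_by h @` eichler0 s.
  apply/seteqP; suff H x : E x <-> eichler0 s (conj_by (invmx h) x).
    by split=> x; rewrite image_conj_by // H.
  have uh' : invmx h \in unitmx by rewrite unitmx_inv.
  have ud' : invmx dl \in unitmx by rewrite unitmx_inv.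
  rewrite EE /setI /= D1x D2x (invmxM uh ud) (conj_byM _ ud' uh').
  elim/mx2_ind: (conj_by (invmx h) x) => a b c d.
  have -> : conj_by (invmx dl) (mx2 a b c d) = mx2 a (pi ^+ s * b) (c / pi ^+ s) d.
    apply/conj_by_eq; first by rewrite unitmx_inv.
    apply: (canLR (mulKmx ud)); rewrite mulmxA; apply: (canRL (mulmxK ud)).
    by rewrite !mx2M; congr mx2; field.
  have E1 := val_ideal_divexpu hk hpi 0 s c; rewrite add0r in E1.
  rewrite !eichler0_mx2; split=> [[[ha hb hc hd] [_ _ /E1 hc' _]]|[ha hb hc hd]].
    by split.
  split; split => //; first by apply: val_idealW hc; lia.
    by apply: (integersMl hk) => //; apply/(val_ideal_expu hk hpi).
  exact/E1.
suff -> : r = s by exists h.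
apply: (quotient_iso_level uh); rewrite -Ex.
suff <- : D1 = conj_by h @` eichler0 0 by [].
by apply/seteqP; split=> x; rewrite image_conj_by // D1x.
Qed.

End EichlerStandard.

(** * Embeddings as conjugations *)

Section AlgebraMorphisms.
Variable k : fieldType.
Local Notation M2 := 'M[k]_2.

(** If the determinant is 0, then g annihilates its adjugate, so the adjugate and with it g vanish,
    and g also annihilates 1. *)
Lemma unitmx_intro (g : M2) : (forall x : M2, g *m x = 0 -> x = 0) -> g \in unitmx.
Proof.
elim/mx2_ind: g => a b c d h; rewrite mx2_unit; apply/eqP => D0.
have /h : mx2 a b c d *m mx2 d (- b) (- c) a = 0.
  by rewrite mx2M mx2_0; congr mx2; try ring; rewrite -[RHS]D0; ring.
rewrite mx2_0 => /mx2_inj[d0 /eqP b0 /eqP c0 a0].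
rewrite oppr_eq0 in b0; rewrite oppr_eq0 in c0.
have /h : mx2 a b c d *m 1%:M = 0.
  by rewrite mulmx1 a0 d0 (eqP b0) (eqP c0) mx2_0.
by rewrite mx2_scalar mx2_0 => /mx2_inj[/eqP]; rewrite oner_eq0.
Qed.

(* The columns of g are N y and (1 - P) y for a vector y not killed by N. *)
Lemma matrix_units_conj (P N : M2) : P *m P = P -> P *m N = N -> N *m P = 0 ->
  N *m N = 0 -> N != 0 ->
  exists g, [/\ g \in unitmx, conj_by g (mx2 1 0 0 0) = P &
                conj_by g (mx2 0 1 0 0) = N].
Proof.
move=> PP PN NP NN N0.
have [a [b Y0]] : exists a b, N *m mx2 0 a 0 b != 0.
  move: N0; rewrite [N]mx2_eta => N0; apply: contrapT => h.
  have z a b : N *m mx2 0 a 0 b = 0.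
    by apply/eqP; apply: contrapT => /negP e; apply: h; exists a, b; rewrite -mx2_eta.
  move: (z 1 0) (z 0 1); rewrite [N]mx2_eta !mx2M mx2_0.
  rewrite !(mulr0, mulr1, addr0, add0r) => /mx2_inj[_ e1 _ e2] /mx2_inj[_ e3 _ e4].
  by move/eqP: N0; rewrite e1 e2 e3 e4 -mx2_0.
(* The vector y is stored as the second column of a square matrix, so that all products stay in
   M_2(k). *)
set Y := mx2 0 a 0 b in Y0; pose e21 : M2 := mx2 0 0 1 0.
pose g := N *m Y *m e21 + (1%:M - P) *m Y.
have e0 : 0 = mx2 0 0 0 0 :> M2 by apply: mx2_0.
have Y11 : Y *m mx2 1 0 0 0 = 0 by rewrite mx2M e0; congr mx2; ring.
have Y12 : Y *m mx2 0 1 0 0 = 0 by rewrite mx2M e0; congr mx2; ring.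
have Y22 : Y *m mx2 0 0 0 1 = Y by rewrite mx2M; congr mx2; ring.
have g11 : g *m mx2 1 0 0 0 = P *m g.
  rewrite /g mulmxDl mulmxDr -!mulmxA Y11 !mulmx0 addr0 !mulmxA PN mulmxBr PP.
  rewrite mulmx1 subrr mul0mx addr0 -!mulmxA; do 2 congr (_ *m _).
  by rewrite mx2M; congr mx2; ring.
have Ng : N *m g = N *m Y.
  by rewrite /g mulmxDr !mulmxA NN !mul0mx add0r mulmxBr mulmx1 NP subr0.
have g12 : g *m mx2 0 1 0 0 = N *m g.
  rewrite Ng /g mulmxDl -!mulmxA Y12 !mulmx0 addr0.
  have -> : e21 *m mx2 0 1 0 0 = mx2 0 0 0 1 by rewrite mx2M; congr mx2; ring.
  by rewrite Y22.
have NYinj (x : M2) : N *m Y *m x = 0 -> x 1 0 = 0 /\ x 1 1 = 0.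
  move: Y0; rewrite [N]mx2_eta [x]mx2_eta mx2M !(mulr0, addr0) !mx2E.
  set p := (X in mx2 0 X 0 _); set q := (X in mx2 0 _ 0 X).
  rewrite mx2M e0 !(mul0r, add0r) => Y0 /mx2_inj[/eqP z1 /eqP z2 /eqP z3 /eqP z4].
  rewrite !mulf_eq0 in z1 z2 z3 z4.
  have : (p != 0) || (q != 0).
    by rewrite -negb_and; apply: contra Y0 => /andP[/eqP -> /eqP ->].
  case/orP=> /negbTE e.
    by rewrite e /= in z1 z2; split; apply/eqP.
  by rewrite e /= in z3 z4; split; apply/eqP.
have ug : g \in unitmx.
  apply: unitmx_intro => x gx.
  have [x10 x11] : x 1 0 = 0 /\ x 1 1 = 0.
    by apply: NYinj; rewrite -Ng -mulmxA gx mulmx0.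
  have Yx : Y *m x = 0.
    by rewrite [x]mx2_eta x10 x11 mx2M e0; congr mx2; ring.
  move: gx; rewrite /g mulmxDl -!mulmxA Yx mulmx0 addr0 mulmxA => /NYinj.
  rewrite [x]mx2_eta mx2M !mx2E !(mul0r, mul1r, addr0) => -[x00 x01].
  by rewrite x00 x01 x10 x11 e0.
by exists g; split => //; apply/conj_by_eq.
Qed.

(** A substitute for the Skolem-Noether theorem on a non-simple algebra. A is spanned by 1, q e11
    and q e12, and the images of the last two divided by q satisfy the relations of
    [matrix_units_conj]. With S = k and q = 1 it applies to the span of H, with S = O and q = pi^t
    to H itself. *)
Lemma alg_morph_conj (S : set k) (q : k) (A : set M2) (f : M2 -> M2) :
  S 0 -> S 1 -> S q -> q != 0 ->
  (forall x, A x <-> exists a b d,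
     [/\ S a, S b, S d & x = mx2 (d + q * a) (q * b) 0 d]) ->
  alg_morph_on S A f -> set_inj A f ->
  exists2 g, g \in unitmx & forall x, A x -> f x = conj_by g x.
Proof.
move=> S0 S1 Sq q0 AP [f1 fD fM fZ] finj.
have A11 a : S a -> A (mx2 (q * a) 0 0 0).
  by move=> Sa; apply/AP; exists a, 0, 0; split => //; rewrite add0r mulr0.
have A12 b : S b -> A (mx2 0 (q * b) 0 0).
  by move=> Sb; apply/AP; exists 0, b, 0; split => //; rewrite mulr0 addr0.
have Ad d : S d -> A d%:M.
  move=> Sd; apply/AP; exists 0, 0, d; split => //.
  by rewrite mx2_scalar mulr0 addr0.
have A0 : A 0.
  by have := A11 0 S0; rewrite mulr0 -mx2_0.
have f0 : f 0 = 0 by have := fZ 0 0 S0 A0; rewrite !scale0r.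
pose P := q^-1 *: f (mx2 q 0 0 0); pose N := q^-1 *: f (mx2 0 q 0 0).
have Aq1 : A (mx2 q 0 0 0) by have := A11 1 S1; rewrite mulr1.
have Aq2 : A (mx2 0 q 0 0) by have := A12 1 S1; rewrite mulr1.
have mulE x y z : A x -> A y -> A z -> x *m y = q *: z ->
    (q^-1 *: f x) *m (q^-1 *: f y) = q^-1 *: f z.
  move=> Ax Ay Az xy; rewrite -scalemxAl -scalemxAr -fM // xy fZ // !scalerA.
  by rewrite mulrVK ?unitfE //.
have [g [ug gP gN]] : exists g, [/\ g \in unitmx, conj_by g (mx2 1 0 0 0) = P &
    conj_by g (mx2 0 1 0 0) = N].
  have Z : q^-1 *: f 0 = 0 by rewrite f0 scaler0.
  apply: matrix_units_conj.
  - by apply: mulE => //; rewrite mx2M mx2Z; congr mx2; ring.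
  - by apply: mulE => //; rewrite mx2M mx2Z; congr mx2; ring.
  - by rewrite -[RHS]Z; apply: mulE => //; rewrite mx2M mx2_0 mx2Z; congr mx2; ring.
  - by rewrite -[RHS]Z; apply: mulE => //; rewrite mx2M mx2_0 mx2Z; congr mx2; ring.
  rewrite scaler_eq0 invr_eq0 (negbTE q0) /=; apply/eqP => fN.
  have := finj _ _ (mem_set Aq2) (mem_set A0); rewrite fN f0 => /(_ erefl).
  by rewrite mx2_0 => /mx2_inj[_ /eqP]; rewrite (negbTE q0).
exists g => // x /AP[a [b [d [Sa Sb Sd ->]]]].
have -> : mx2 (d + q * a) (q * b) 0 d =
    d *: 1%:M + (a *: mx2 q 0 0 0 + b *: mx2 0 q 0 0).
  by rewrite mx2_scalar !mx2Z !mx2D; congr mx2; ring.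
have Aa : A (a *: mx2 q 0 0 0).
  by rewrite mx2Z mulr0 mulrC; apply: A11.
have Ab : A (b *: mx2 0 q 0 0).
  by rewrite mx2Z mulr0 [b * q]mulrC; apply: A12.
have Aab : A (a *: mx2 q 0 0 0 + b *: mx2 0 q 0 0).
  apply/AP; exists a, b, 0; split => //.
  by rewrite !mx2Z !mx2D; congr mx2; ring.
have A1 : A 1%:M by apply: Ad.
have Adm : A (d *: 1%:M) by rewrite scalemx1; apply: Ad.
rewrite !fD // !fZ // f1 !conj_by_add !conj_by_scale conj_by_one //.
have -> : mx2 q 0 0 0 = q *: mx2 1 0 0 0 by rewrite mx2Z mulr1 mulr0.
have -> : mx2 0 q 0 0 = q *: mx2 0 1 0 0 by rewrite mx2Z mulr1 mulr0.
rewrite !conj_by_scale gP gN /P /N !scalerA.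
by rewrite -!mulrA mulfV // !mulr1 !mx2Z !mulr1 !mulr0.
Qed.

End AlgebraMorphisms.

(** * Optimal embeddings and suborders as conjugators *)

Section Embeddings.
Variables (k : fieldType) (v : k -> int).
Hypothesis hk : local_field v.
Variable pi : k.
Hypothesis hpi : uniformizer v pi.
Local Notation I := (val_ideal v).
Local Notation M2 := 'M[k]_2.
Local Notation upper_pi := (upper_pi v pi).

Lemma upper_piP t x : upper_pi t x <-> exists a b d,
  [/\ I 0 a, I 0 b, I 0 d & x = mx2 (d + pi ^+ t * a) (pi ^+ t * b) 0 d].
Proof.
split=> [|[a [b [d [ha hb hd ->]]]]].
  elim/mx2_ind: x => a b c d; rewrite (upper_pi_mx2 hk hpi).
  move=> [ha hd -> /(val_ideal_factor hk hpi)[b' hb' ->]].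
  move=> /(val_ideal_factor hk hpi)[a' ha' E].
  by exists a', b', d; split => //; rewrite -E addrC subrK.
have tO x' : I 0 x' -> I t%:Z (pi ^+ t * x').
  by rewrite (val_ideal_Mexpu hk hpi) subrr.
rewrite (upper_pi_mx2 hk hpi); split; auto; last first.
  by rewrite addrC addKr; apply: tO.
by apply: (val_idealD hk) => //; apply: val_idealW (tO _ ha); lia.
Qed.

Lemma upper_pi10 t x : upper_pi t x -> x 1 0 = 0.
Proof. by move=> /upper_piP[a [b [d [_ _ _ ->]]]]; rewrite mx2E. Qed.

Lemma kspan_upper_pi t x : kspan (upper_pi t) x <-> x 1 0 = 0.
Proof.
have p0 := expu_neq0 hpi t; have O0 := val_ideal0 v 0; have O1 := integers1 hk.
split.
  move: x; apply: lin_span_sub => [|x y|a x _ /upper_pi10]; rewrite mxE //.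
    by move=> -> ->; rewrite addr0.
  by move=> ->; rewrite mulr0.
elim/mx2_ind: x => a b c d; rewrite mx2_10 => ->.
have -> : mx2 a b 0 d = d *: mx2 1 0 0 1 +
    ((a - d) / pi ^+ t) *: mx2 (pi ^+ t) 0 0 0 + (b / pi ^+ t) *: mx2 0 (pi ^+ t) 0 0.
  by rewrite !mx2Z !mx2D; congr mx2; field.
apply: lin_spanD; first apply: lin_spanD.
all: apply: lin_span_scale => //; apply/upper_piP.
- by exists 0, 0, 1; split => //; congr mx2; ring.
- by exists 1, 0, 0; split => //; congr mx2; ring.
- by exists 0, 1, 0; split => //; congr mx2; ring.
Qed.

Lemma alg_morph_conj_by S (A : set M2) g : g \in unitmx ->
  alg_morph_on S A (conj_by g).
Proof.
move=> ug; split=> [|x y _ _|x y _ _|a x _ _].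
- exact: conj_by_one.
- exact: conj_by_add.
- exact: conj_by_mul.
- exact: conj_by_scale.
Qed.

Lemma conj_by_inj (g : M2) : g \in unitmx -> injective (conj_by g).
Proof. by move=> /conj_byK; apply: can_inj. Qed.

(** The extension to the span of H is a conjugation, and the condition that E pulls back to H is
    then literally the one in [optimal_conj]. *)
Lemma optimal_embeddingsP t (E : set M2) (f : upper_pi t -> M2) :
  optimal_embeddings E (upper_pi t) f <->
  exists2 g, optimal_conj E (upper_pi t) g & f = fun x => conj_by g (val x).
Proof.
split=> [[phi [hphi phiI phiE fE]]|[g [ug gE] ->]].
  have [||||x|g ug gE] := alg_morph_conj _ _ _ _ _ hphi phiI (q := 1) => //.
  - exact: oner_neq0.
  - rewrite kspan_upper_pi; split=> [|[a [b [d [_ _ _ ->]]]]]; last by rewrite mx2E.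
    elim/mx2_ind: x => a b c d; rewrite mx2_10 => ->.
    by exists (a - d), b, d; split => //; congr mx2; ring.
  exists g; last first.
    apply: funext => x; rewrite fE gE //; apply/kspan_upper_pi.
    by apply: (@upper_pi10 t); apply: set_mem; apply: valP.
  split=> // x x0; have kx : kspan (upper_pi t) x by apply/kspan_upper_pi.
  by rewrite -gE // -[in X in _ <-> X]phiE; split=> [|[]].
exists (conj_by g); split => //.
- exact: alg_morph_conj_by.
- by move=> x y _ _; apply: conj_by_inj.
apply/seteqP; split=> x /=; first by move=> [/kspan_upper_pi x0 /gE]; apply.
move=> hx; have x0 := upper_pi10 hx.
by split; [apply/kspan_upper_pi|apply/gE].
Qed.

(** The isomorphism from H to A is already a conjugation at the integral level, so the span of A is
    the conjugate of the upper triangular algebra and optimality of A pulls back to it. *)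
Lemma optimal_subordersP t (E A : set M2) :
  optimal_suborders v E (upper_pi t) A <->
  exists2 g, optimal_conj E (upper_pi t) g & A = conj_by g @` upper_pi t.
Proof.
split=> [[_ AE AkE [f [hf [fA fI fS]]]]|[g [ug gE] ->]].
  have [||||x|g ug gE] := alg_morph_conj _ _ _ _ _ hf fI (q := pi ^+ t).
  - exact: val_ideal0.
  - exact: integers1.
  - by apply/(val_ideal_expu hk hpi).
  - exact: (expu_neq0 hpi).
  - exact: upper_piP.
  have Ag : A = conj_by g @` upper_pi t.
    apply/seteqP; split=> [y /fS[x hx <-]|_ [x hx <-]].
      by exists x => //; rewrite gE.
    by rewrite -gE //; apply: fA.
  exists g => //; split=> // x x0; split=> [Ex|hx]; last first.
    by apply: AE; rewrite Ag; exists x.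
  have : A (conj_by g x).
    rewrite -AkE; split=> //=; rewrite Ag /kspan lin_span_conj //.
    by exists x => //; apply/kspan_upper_pi.
  by rewrite Ag => -[y hy /(conj_by_inj ug) <-].
split.
- by apply: is_order_conj => //; apply: is_order_upper_pi.
- by move=> _ [x hx <-]; apply/gE => //; apply: upper_pi10 hx.
- apply/seteqP; split=> [x|_ [y hy <-]].
    rewrite /kspan lin_span_conj // => -[[y /kspan_upper_pi y0 <-] /=].
    by move/(gE _ y0) => hy; exists y.
  have y0 := upper_pi10 hy; split; last by apply/gE.
  by rewrite /kspan lin_span_conj //; exists y => //; apply/kspan_upper_pi.
exists (conj_by g); split; first exact: alg_morph_conj_by.
split=> [x hx|x y _ _|x []//]; first by exists x.
  exact: conj_by_inj.
by move=> y hy <-; exists y.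
Qed.

(** The centralizer of H is scalar: commuting with pi^t e11 makes a matrix diagonal, and commuting
    with pi^t e12 makes its diagonal entries equal. *)
Lemma conj_by_upper_pi_inj t (g g' : M2) : g \in unitmx -> g' \in unitmx ->
  (forall x, upper_pi t x -> conj_by g x = conj_by g' x) ->
  exists2 a : k, a != 0 & g' = a *: g.
Proof.
move=> ug ug' h; pose c := invmx g *m g'.
have O0 := val_ideal0 v 0; have O1 := integers1 hk.
have p0 := expu_neq0 hpi t.
have uc : c \in unitmx by rewrite unitmx_mul unitmx_inv ug.
have hc x : upper_pi t x -> c *m x = x *m c.
  move=> hx; apply/(conj_by_eq _ _ uc).
  by rewrite conj_byM ?unitmx_inv // -h // conj_byK.
have g'E : g' = g *m c by rewrite /c mulKVmx.
suff [a cE] : exists a : k, c = a%:M.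
  exists a; last by rewrite g'E cE mul_mx_scalar.
  apply/eqP => a0; move: uc; rewrite cE a0 mx2_scalar mx2_unit mulr0 subr0.
  by rewrite eqxx.
have h11 : upper_pi t (mx2 (pi ^+ t) 0 0 0).
  by apply/upper_piP; exists 1, 0, 0; split => //; congr mx2; ring.
have h12 : upper_pi t (mx2 0 (pi ^+ t) 0 0).
  by apply/upper_piP; exists 0, 1, 0; split => //; congr mx2; ring.
move: (hc _ h11) (hc _ h12); elim/mx2_ind: (c) => x y z w.
rewrite !mx2M !(mulr0, mul0r, addr0, add0r).
move=> /mx2_inj[_ e1 e2 _] /mx2_inj[_ e3 _ _].
exists x; rewrite mx2_scalar; congr mx2.
- by apply: (mulfI p0); rewrite -e1 mulr0.
- by apply: (mulIf p0); rewrite e2 mul0r.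
- by apply: (mulfI p0); rewrite -e3 mulrC.
Qed.

End Embeddings.

(** * Counting tools *)

Lemma card_eq_finType (T : Type) (A : set T) (J : finType) (f : J -> T) :
  set_bij [set: J] A f -> A #= `I_#|J|.
Proof.
move=> /Pbij[F _]; have AJ : [set: J] #= A := pcard_eq F.
have /Pbij[G _] : set_bij [set: J] [set: 'I_#|J|] enum_rank.
  split=> [//|x y _ _|i _]; first exact: enum_rank_inj.
  by exists (enum_val i) => //; rewrite enum_valK.
have JI : [set: J] #= [set: 'I_#|J|] := pcard_eq G.
by rewrite (card_eqr card_II) -(card_eql AJ).
Qed.

Lemma card_classes (T : Type) (X : set T) (R : T -> T -> Prop) (J : finType)
    (rho : J -> T) :
  (forall x y, R x y -> R y x) -> (forall x y z, R x y -> R y z -> R x z) ->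
  (forall j, X (rho j)) -> (forall x, X x -> exists j, R (rho j) x) ->
  (forall i j, R (rho i) (rho j) -> i = j) -> classes_of X R #= `I_#|J|.
Proof.
move=> Rsym Rtrans Xrho cover sep.
apply: (@card_eq_finType _ _ J (fun j => [set y | X y /\ R (rho j) y])).
(* Reflexivity at a representative follows from symmetry and transitivity, since some representative
   is related to it. *)
have Rrefl j : R (rho j) (rho j).
  have [i Rij] := cover _ (Xrho j).
  exact: Rtrans (Rsym _ _ Rij) Rij.
split.
- by move=> j _; exists (rho j).
- move=> i j _ _ /seteqP[_ /(_ (rho j))[]//= _]; exact: sep.
move=> _ [x Xx <-]; have [j Rjx] := cover _ Xx; exists j => //.
apply/seteqP; split=> y /= [Xy Ry]; split=> //.
  exact: Rtrans (Rsym _ _ Rjx) Ry.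
exact: Rtrans Rjx Ry.
Qed.

(** From each two-element orbit the member with the smaller [enum_rank] is kept. *)
Lemma free_involution_reps (J : finType) (iota : J -> J) :
  involutive iota -> (forall a, iota a != a) ->
  exists (J' : finType) (h : J' -> J),
    [/\ (#|J'| * 2 = #|J|)%N, forall a, exists j, a = h j \/ a = iota (h j) &
        forall i j, h i = h j \/ h i = iota (h j) -> i = j].
Proof.
move=> invo free.
pose P a := (enum_rank a < enum_rank (iota a))%N.
have PC a : P (iota a) = ~~ P a.
  rewrite /P invo -leqNgt ltn_neqAle andb_idl // => _.
  apply/eqP => /val_inj /enum_rank_inj e.
  by move: (free a); rewrite e eqxx.
exists {a | P a}, val; split.
- rewrite card_sig muln2 -addnn -(cardC [pred a | P a]); congr (_ + _)%N.
  rewrite -(fintype.card_image (can_inj invo) [pred a | P a]); apply: eq_card => a.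
  rewrite [RHS](_ : _ = P (iota a)); last by rewrite PC.
  apply/fintype.imageP/idP => [[b Pb ->]|Pa].
    by rewrite invo.
  by exists (iota a); rewrite ?invo.
- move=> a; case: (boolP (P a)) => Pa; first by exists (Sub a Pa); left.
  rewrite -PC in Pa; exists (Sub (iota a) Pa); right.
  by rewrite /= invo.
move=> [i Pi] [j Pj] /= [ij|ij]; apply: val_inj => //=.
by move: Pi; rewrite ij PC Pj.
Qed.

(** * Representatives of O/pi^t and of its units *)

Section Residues.
Variables (k : fieldType) (v : k -> int).
Hypothesis hk : local_field v.
Variable pi : k.
Hypothesis hpi : uniformizer v pi.
Variable p : nat.
Hypothesis hp : residue_field v #= `I_p.
Local Notation I := (val_ideal v).

Lemma residue_reps : exists s : 'I_p -> k,
  [/\ forall i, I 0 (s i), forall x, I 0 x -> exists i, I 1 (x - s i) &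
      forall i j, I 1 (s i - s j) -> i = j].
Proof.
have : [set: 'I_p] #= residue_field v.
  by rewrite -(card_eql card_II) card_eq_sym.
move=> /card_set_bijP[F [Fres Finj Fsurj]].
have /boolp.choice[s sP] (i : 'I_p) :
    exists x, I 0 x /\ [set y | I 0 y /\ I 1 (x - y)] = F i.
  by have [x xO xF] := Fres i Logic.I; exists x.
exists s; split=> [i|x xO|i j ij]; first by case: (sP i).
  have [i _ iF] := Fsurj _ (ex_intro2 _ _ x xO erefl).
  exists i; have [sO sF] := sP i; have /seteqP[/(_ (s i))h _] := etrans sF iF.
  by case: h => //; split=> //; rewrite subrr; left.
apply: Finj; rewrite ?inE //; have [_ <-] := sP i; have [_ <-] := sP j.
apply/seteqP; split=> y /= [yO ys]; split=> //.
  rewrite -(subrKA (s i)); apply: (val_idealD hk) => //.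
  by rewrite -opprB; apply: (val_idealN hk).
by rewrite -(subrKA (s j)); apply: (val_idealD hk).
Qed.

(** Expansion in powers of pi: an element is a residue digit plus pi times an element known modulo
    pi^t. *)
Lemma integers_mod_reps t : exists (W : finType) (w : W -> k),
  [/\ #|W| = (p ^ t)%N, forall i, I 0 (w i),
      forall x, I 0 x -> exists i, I t%:Z (x - w i) &
      forall i j, I t%:Z (w i - w j) -> i = j].
Proof.
have O0 n := val_ideal0 v n; have [s [sO scover sinj]] := residue_reps.
elim: t => [|t [W [w [cW wO wcover winj]]]].
  exists unit, (fun=> 0); split=> // [|x xO|[] []//]; first by rewrite card_unit.
  by exists tt; rewrite subr0.
have pi1 x : I 0 x -> I 1 (pi * x).
  by move=> xO; rewrite -[pi]expr1 (val_ideal_Mexpu hk hpi).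
have piS n x : I n.+1%:Z (pi * x) <-> I n%:Z x.
  rewrite -[pi]expr1 (val_ideal_Mexpu hk hpi).
  by have -> : n.+1%:Z - 1%:Z = n%:Z by lia.
exists ('I_p * W)%type, (fun ij => s ij.1 + pi * w ij.2); split.
- by rewrite card_prod card_ord cW expnS.
- move=> i; apply: (val_idealD hk) => //; apply: val_idealW (pi1 _ _) => //.
- move=> x xO; have [i xi] := scover _ xO.
  have xi' : I 1%:Z (x - s i) by [].
  have [y yO yE] := val_ideal_factor hk hpi xi'.
  have [j yj] := wcover _ yO; exists (i, j) => /=.
  by rewrite opprD addrA yE expr1 -mulrBr piS.
move=> [i j] [i' j'] /= h.
have E : s i + pi * w j - (s i' + pi * w j') = (s i - s i') + pi * (w j - w j').
  by ring.
have ii : i = i'.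
  apply: sinj; rewrite -[_ - _](addrK (pi * (w j - w j'))) -E.
  apply: (val_idealB hk); first by apply: val_idealW h; lia.
  by apply: pi1; apply: (val_idealB hk).
by rewrite E ii subrr add0r piS in h; rewrite ii (winj _ _ h).
Qed.

(** A unit is an element whose lowest digit is not the one representing 0, so only that digit is
    restricted. For t = 0 the quotient is the zero ring, whose unit group has one element. *)
Lemma units_mod_reps t : exists (U : finType) (u : U -> k),
  [/\ #|U| = (if t is s.+1 then (p - 1) * p ^ s else 1)%N,
      forall i, unitO v (u i),
      forall x, unitO v x -> exists i, I t%:Z (x - u i) &
      forall i j, I t%:Z (u i - u j) -> i = j].
Proof.
have O0 n := val_ideal0 v n; have [s [sO scover sinj]] := residue_reps.
case: t => [|t].
  exists unit, (fun=> 1); split=> // [|_|x /(unitOP hk)[_ xO _]|[] []//].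
  - by rewrite card_unit.
  - exact: unitO1.
  - by exists tt; apply: (val_idealB hk) => //; apply: integers1.
have [W [w [cW wO wcover winj]]] := integers_mod_reps t.
have pi1 x : I 0 x -> I 1 (pi * x).
  by move=> xO; rewrite -[pi]expr1 (val_ideal_Mexpu hk hpi).
have piS n x : I n.+1%:Z (pi * x) <-> I n%:Z x.
  rewrite -[pi]expr1 (val_ideal_Mexpu hk hpi).
  by have -> : n.+1%:Z - 1%:Z = n%:Z by lia.
have [i0 si0] := scover 0 (O0 0).
have su i : i != i0 -> unitO v (s i).
  move=> ii0; case: (boolP (unitO v (s i))) => // /(nonunitO (sO i)) s1.
  case/eqP: ii0; apply: sinj; rewrite -[s i]addr0 -addrA.
  exact: (val_idealD hk).
exists ({i | i != i0} * W)%type, (fun ij => s (val ij.1) + pi * w ij.2); split.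
- rewrite card_prod card_sig cW; congr (_ * _)%N.
  by have := cardC1 i0; rewrite card_ord subn1 => <-; apply: eq_card.
- move=> [[i ii0] j] /=; apply: (unitO_congr hk (su i ii0)).
  by rewrite opprD addNKr; apply: (val_idealN hk); apply: pi1.
- move=> x ux; have [_ xO _] := unitOP hk ux; have [i xi] := scover _ xO.
  have ii0 : i != i0.
    apply/eqP => ii0; apply: (unitO_val_ideal1 ux).
    rewrite -[x](subrK (s i)); apply: (val_idealD hk) => //.
    by have := val_idealN hk si0; rewrite sub0r opprK ii0.
  have xi' : I 1%:Z (x - s i) by [].
  have [y yO yE] := val_ideal_factor hk hpi xi'.
  have [j yj] := wcover _ yO; exists (Sub i ii0, j) => /=.
  by rewrite opprD addrA yE expr1 -mulrBr piS.
move=> [[i hi] j] [[i' hi'] j'] /= h.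
have E : s i + pi * w j - (s i' + pi * w j') = (s i - s i') + pi * (w j - w j').
  by ring.
have ii : i = i'.
  apply: sinj; rewrite -[_ - _](addrK (pi * (w j - w j'))) -E.
  apply: (val_idealB hk); first by apply: val_idealW h; lia.
  by apply: pi1; apply: (val_idealB hk).
rewrite E ii subrr add0r piS in h; rewrite (winj _ _ h); congr pair.
exact: val_inj.
Qed.

End Residues.

(** * Orbits *)

Section Transport.
Variable k : fieldType.
Local Notation M2 := 'M[k]_2.
Implicit Types (E : set M2) (g h : M2).

Lemma image_conj_byK h E : h \in unitmx ->
  conj_by (invmx h) @` (conj_by h @` E) = E.
Proof.
move=> uh; apply/seteqP; split=> [_ [_ [x Ex <-] <-]|x Ex].
  by rewrite conj_byK.
by exists (conj_by h x); [exists x|rewrite conj_byK].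
Qed.

Lemma conj_by_unitmx h g : h \in unitmx -> (conj_by h g \in unitmx) = (g \in unitmx).
Proof. by move=> uh; rewrite !unitmx_mul unitmx_inv uh andbT. Qed.

Lemma conj_by_inv h g : h \in unitmx -> g \in unitmx ->
  invmx (conj_by h g) = conj_by h (invmx g).
Proof.
move=> uh ug; apply: invmx_unique.
by rewrite -conj_by_mul // mulmxV // conj_by_one.
Qed.

Lemma Gamma1_image h E g : h \in unitmx -> Gamma1 E g ->
  Gamma1 (conj_by h @` E) (conj_by h g).
Proof.
move=> uh [a [u [a0 uu Eu EV ->]]]; exists a, (conj_by h u); split => //.
- by rewrite conj_by_unitmx.
- by rewrite conj_by_inv; [exists (invmx u)|..].
- exact: conj_by_scale.
Qed.

Lemma Gamma2_image h E g : h \in unitmx -> Gamma2 E g ->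
  Gamma2 (conj_by h @` E) (conj_by h g).
Proof.
move=> uh /Gamma2P[ug gE]; apply/Gamma2P; rewrite conj_by_unitmx //.
split=> // x; rewrite !image_conj_by // gE.
suff -> : conj_by g (conj_by (invmx h) x) =
          conj_by (invmx h) (conj_by (conj_by h g) x) by [].
rewrite -conj_byM ?unitmx_inv // -conj_byM ?conj_by_unitmx ?unitmx_inv //.
by rewrite /conj_by !mulmxA mulVmx // mul1mx.
Qed.

(** Only the target order is conjugated while H stays fixed, so conjugators are translated on the
    left. *)
Lemma optimal_conj_image h E H g : h \in unitmx ->
  optimal_conj (conj_by h @` E) H (h *m g) <-> optimal_conj E H g.
Proof.
move=> uh; rewrite /optimal_conj /= unitmx_mul uh.
have e x : g \in unitmx ->
    (conj_by h @` E) (conj_by (h *m g) x) <-> E (conj_by g x).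
  by move=> ug; rewrite image_conj_by // conj_byM // conj_byK.
by split=> -[ug gE]; split=> // x x0; rewrite -gE //; split; move/(e x ug).
Qed.

End Transport.

(** * Orbits as cosets and double cosets *)

Section Orbits.
Variables (k : fieldType) (v : k -> int).
Hypothesis hk : local_field v.
Variable pi : k.
Hypothesis hpi : uniformizer v pi.
Local Notation I := (val_ideal v).
Local Notation M2 := 'M[k]_2.
Local Notation eichler0 := (eichler0 v).
Local Notation upper_pi := (upper_pi v pi).
Local Notation swapmx := (swapmx pi).
Local Notation swappow := (swappow pi).
Local Notation basemx := (basemx pi).

(** The properties shared by the two acting groups. Stability under scalars matters because an
    embedding fixes its conjugator only up to k^*. *)
Record conj_group (G : set M2) : Prop := ConjGroup {
  conj_group_unit : forall g, G g -> g \in unitmx;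
  conj_groupZ : forall (a : k) g, a != 0 -> G g -> G (a *: g);
  conj_group_inv : forall g, G g -> G (invmx g);
  conj_group_mul : forall g g', G g -> G g' -> G (g *m g') }.

Lemma Gamma1_group r : conj_group (Gamma1 (eichler0 r)).
Proof.
split.
- exact: Gamma1_unitmx.
- exact: Gamma1Z.
- exact: Gamma1_inv.
- by move=> g g'; apply: Gamma1_mul; apply: eichler0_mul.
Qed.

Lemma Gamma2_group (E : set M2) : conj_group (Gamma2 E).
Proof.
split.
- by move=> g /Gamma2P[].
- move=> a g a0 /Gamma2P[ug gE]; apply/Gamma2P; split=> [|x].
    exact: unitmx_scale.
  by rewrite conj_byZ.
- exact: Gamma2_inv.
- exact: Gamma2_mul.
Qed.

Variables (h : M2) (t : nat) (E : set M2) (G G' : set M2).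
Hypothesis uh : h \in unitmx.
Hypothesis hG : conj_group G.
Hypothesis hGG' : G' = conj_by h @` G.
Let E' := conj_by h @` E.
Let H := upper_pi t.

Let G'_unit g : G' g -> g \in unitmx.
Proof.
rewrite hGG' => -[g0 Gg0 <-]; rewrite conj_by_unitmx //.
exact: (conj_group_unit hG).
Qed.

Let G'_inv g : G' g -> G' (invmx g).
Proof.
rewrite hGG' => -[g0 Gg0 <-]; have ug0 := conj_group_unit hG Gg0.
by rewrite conj_by_inv //; exists (invmx g0) => //; apply: (conj_group_inv hG).
Qed.

Let G'_mul g g' : G' g -> G' g' -> G' (g *m g').
Proof.
rewrite hGG' => -[g0 Gg0 <-] [g1 Gg1 <-]; exists (g0 *m g1).
  exact: (conj_group_mul hG).
exact: conj_by_mul.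
Qed.

(** Equal embeddings have proportional conjugators and G contains k^*, so orbits are the cosets of G
    in the set of optimal conjugators. The hypotheses concern E, the conclusion its conjugate by
    h. *)
Lemma card_embedding_orbits (J : finType) (rho : J -> M2) :
  (forall j, optimal_conj E H (rho j)) ->
  (forall g, optimal_conj E H g -> exists j g0, G g0 /\ g = g0 *m rho j) ->
  (forall i j g, G g -> rho j = g *m rho i -> i = j) ->
  embedding_orbits E' H G' #= `I_#|J|.
Proof.
move=> rhoP cover sep; have urho j : rho j \in unitmx by case: (rhoP j).
have uhrho j : h *m rho j \in unitmx by rewrite unitmx_mul uh urho.
have uc g : G g -> conj_by h g \in unitmx.
  by move=> Gg; rewrite conj_by_unitmx //; apply: (conj_group_unit hG).
pose emb g : H -> M2 := fun x => conj_by g (val x).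
apply: (@card_classes _ _ _ _ (fun j => emb (h *m rho j))).
- move=> x y [g Gg ->]; exists (invmx g); first exact: G'_inv.
  by apply: funext => z; rewrite conj_byK // G'_unit.
- move=> x y z [g Gg ->] [g' Gg' ->]; exists (g' *m g); first exact: G'_mul.
  by apply: funext => w; rewrite conj_byM // G'_unit.
- move=> j; apply/(optimal_embeddingsP hk hpi); exists (h *m rho j) => //.
  exact/optimal_conj_image.
- move=> f /(optimal_embeddingsP hk hpi)[g gP ->].
  have g'P : optimal_conj E H (invmx h *m g).
    by apply/(optimal_conj_image E H _ uh); rewrite mulKVmx.
  have [j [g0 [Gg0 gE]]] := cover _ g'P.
    exists j, (conj_by h g0); first by rewrite hGG'; exists g0.
  apply: funext => x; rewrite /emb -conj_byM ?uc //; congr (conj_by _ _).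
  by rewrite /conj_by -!mulmxA mulKmx // -gE mulKVmx.
move=> i j [g']; rewrite hGG' => -[g Gg <-] eij {g'}.
have ug := conj_group_unit hG Gg.
have [||x Hx|a a0 aE] := @conj_by_upper_pi_inj _ _ hk _ hpi t
    (conj_by h g *m (h *m rho i)) (h *m rho j).
- by rewrite !unitmx_mul uh ug urho unitmx_inv uh.
- by rewrite unitmx_mul uh urho.
- rewrite conj_byM ?uc //.
  have := congr1 (fun f => f (SigSub (mem_set Hx))) eij.
  by rewrite /emb.
apply: (sep i j (a *: g)); first exact: (conj_groupZ hG).
rewrite -[LHS](mulKmx uh) aE -scalemxAr -scalemxAl; congr (_ *: _).
by rewrite {1}/conj_by -!mulmxA !mulKmx.
Qed.

(** A suborder fixes its conjugator only up to the normalizer of H on the right, so orbits are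
    double cosets. *)
Lemma card_suborder_orbits (J : finType) (rho : J -> M2) :
  (forall j, optimal_conj E H (rho j)) ->
  (forall g, optimal_conj E H g -> exists j g0 n,
    [/\ G g0, n \in unitmx, conj_by n @` H = H & g = g0 *m rho j *m n]) ->
  (forall i j g n, G g -> n \in unitmx -> conj_by n @` H = H ->
    rho j = g *m rho i *m n -> i = j) ->
  suborder_orbits v E' H G' #= `I_#|J|.
Proof.
move=> rhoP cover sep; have urho j : rho j \in unitmx by case: (rhoP j).
have uhrho j : h *m rho j \in unitmx by rewrite unitmx_mul uh urho.
have uc g : G g -> conj_by h g \in unitmx.
  by move=> Gg; rewrite conj_by_unitmx //; apply: (conj_group_unit hG).
have imM (g g' : M2) (A : set M2) : g \in unitmx -> g' \in unitmx ->
    conj_by (g *m g') @` A = conj_by g @` (conj_by g' @` A).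
  move=> ug ug'; apply/seteqP; split=> [_ [x Ax <-]|_ [_ [x Ax <-] <-]].
    by exists (conj_by g' x); [exists x|rewrite conj_byM].
  by exists x => //; rewrite conj_byM.
apply: (@card_classes _ _ _ _ (fun j => conj_by (h *m rho j) @` H)).
- move=> x y [g Gg ->]; exists (invmx g); first exact: G'_inv.
  by rewrite image_conj_byK // G'_unit.
- move=> x y z [g Gg ->] [g' Gg' ->]; exists (g' *m g); first exact: G'_mul.
  by rewrite imM // G'_unit.
- move=> j; apply/(optimal_subordersP hk hpi); exists (h *m rho j) => //.
  exact/optimal_conj_image.
- move=> A /(optimal_subordersP hk hpi)[g gP ->].
  have g'P : optimal_conj E H (invmx h *m g).
    by apply/(optimal_conj_image E H _ uh); rewrite mulKVmx.
  have [j [g0 [n [Gg0 un nH gE]]]] := cover _ g'P.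
    exists j, (conj_by h g0); first by rewrite hGG'; exists g0.
  rewrite -imM ?uc //.
  have -> : g = conj_by h g0 *m (h *m rho j) *m n.
    rewrite -[LHS](mulKVmx uh) gE /conj_by -!mulmxA; do 2 congr (_ *m _).
    by rewrite mulKmx.
  by rewrite imM ?nH // unitmx_mul uc // uhrho.
move=> i j [g']; rewrite hGG' => -[g Gg <-] eij {g'}.
have ug := conj_group_unit hG Gg.
pose c := conj_by h g *m (h *m rho i).
have cE : c = h *m (g *m rho i).
  by rewrite /c /conj_by -!mulmxA mulKmx.
have ucc : c \in unitmx by rewrite cE !unitmx_mul uh ug urho.
(* Both c and h rho_j carry H to the same suborder, so their quotient normalizes H. *)
pose n := invmx c *m (h *m rho j).
have un : n \in unitmx by rewrite !unitmx_mul unitmx_inv ucc uh urho.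
apply: (sep i j g n) => //.
  rewrite imM ?unitmx_inv // eij -(imM (conj_by h g)) ?uc //.
  exact: image_conj_byK.
by rewrite -[g *m rho i](mulKmx uh) -cE -mulmxA /n mulKVmx // mulKmx.
Qed.

End Orbits.

(** * Embedding numbers *)

Section Counting.
Variables (k : fieldType) (v : k -> int).
Hypothesis hk : local_field v.
Variable pi : k.
Hypothesis hpi : uniformizer v pi.
Local Notation I := (val_ideal v).
Local Notation M2 := 'M[k]_2.
Local Notation eichler0 := (eichler0 v).
Local Notation upper_pi := (upper_pi v pi).
Local Notation swapmx := (swapmx pi).
Local Notation swappow := (swappow pi).
Local Notation basemx := (basemx pi).
Variables (r t : nat) (h : M2).
Hypotheses (tr : (2 * t <= r)%N) (uh : h \in unitmx).
Let K := Gamma1 (eichler0 r).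
Let H := upper_pi t.
Let P := optimal_conj (eichler0 r) H.
Let E := conj_by h @` eichler0 r.

Let Kgroup : conj_group K := Gamma1_group hk r.
Let G2group : conj_group (Gamma2 (eichler0 r)) := Gamma2_group (eichler0 r).

Let K_G2 (e : M2) : K e -> Gamma2 (eichler0 r) e.
Proof. by apply: Gamma1_sub; apply: eichler0_mul. Qed.

Let G2_swap b : Gamma2 (eichler0 r) (swappow r b) := Gamma2_swappow hk hpi r b.

Let image_Gamma1 : Gamma1 E = conj_by h @` K.
Proof.
apply/seteqP; split=> [g Gg|_ [g Kg <-]]; last exact: Gamma1_image.
apply/image_conj_by => //; rewrite /K -(image_conj_byK (eichler0 r) uh).
by apply: Gamma1_image; rewrite ?unitmx_inv.
Qed.

Let image_Gamma2 : Gamma2 E = conj_by h @` Gamma2 (eichler0 r).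
Proof.
apply/seteqP; split=> [g Gg|_ [g Kg <-]]; last exact: Gamma2_image.
apply/image_conj_by => //; rewrite -(image_conj_byK (eichler0 r) uh).
by apply: Gamma2_image; rewrite ?unitmx_inv.
Qed.

Let normalizes (n : M2) := n \in unitmx /\ conj_by n @` H = H.

Let normalizes_affmx u w : unitO v u -> I 0 w -> normalizes (affmx u w).
Proof.
move=> uu wO; have [u0 _ _] := unitOP hk uu.
have un := affmx_unit w u0; split=> //.
apply/(image_conj_byP _ _ un) => x; elim/mx2_ind: x => a b c d.
split=> [hx|].
  have := upper_pi10 hk hpi hx; rewrite mx2_10 => c0; move: hx; rewrite c0.
  by move/(upper_pi_conj_affmx hk hpi _ _ _ _ uu wO).
have -> : conj_by (affmx u w) (mx2 a b c d) =
    mx2 (a + w * c / u) ((u * b + w * (d - a)) - w * w * c / u)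
        (c / u) (d - w * c / u).
  apply/conj_by_eq => //; rewrite !mx2M; congr mx2; field; rewrite ?u0 //.
move=> hx; have := upper_pi10 hk hpi hx; rewrite mx2_10 => /eqP.
rewrite mulf_eq0 invr_eq0 (negbTE u0) orbF => /eqP c0; move: hx.
rewrite c0 !(mulr0, mul0r, addr0, subr0) => hx.
by apply/(upper_pi_conj_affmx hk hpi _ _ _ _ uu wO); rewrite conj_by_affmx.
Qed.

Variables (U W : finType) (u : U -> k) (w : W -> k).
Hypothesis uU : forall i, unitO v (u i).
Hypothesis ucover : forall x, unitO v x -> exists i, I t%:Z (x - u i).
Hypothesis uinj : forall i j, I t%:Z (u i - u j) -> i = j.
Hypothesis wO : forall i, I 0 (w i).
Hypothesis wcover : forall x, I 0 x -> exists i, I t%:Z (x - w i).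
Hypothesis winj : forall i j, I t%:Z (w i - w j) -> i = j.

Let rep (a : U * W) : M2 := basemx r t *m affmx (u a.1) (w a.2).

Let rep_optimal a : P (rep a).
Proof.
by have := optimal_conj_rep hk hpi false tr (uU a.1) (wO a.2); rewrite mul1mx.
Qed.

Let G2_optimal g x : Gamma2 (eichler0 r) g -> P x -> P (g *m x).
Proof. exact: optimal_conj_mull. Qed.

Let cover_rep u' w' : unitO v u' -> I 0 w' ->
  exists a e, K e /\ basemx r t *m affmx u' w' = e *m rep a.
Proof.
move=> uu wO'; have [i hi] := ucover uu; have [j hj] := wcover wO'.
exists (i, j).
have [_ /(_ (conj hi hj))[e Ke eE]] := rep_congr hk hpi w' tr (uU i) uu (wO j).
by exists e.
Qed.

(** The parameters of the classification are replaced by chosen representatives; the resulting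
    factor in K is conjugated by the swap to reach the left end. *)
Let cover_swap g : P g -> exists b a e, K e /\ g = e *m (swappow r b *m rep a).
Proof.
move=> /(optimal_conj_classify hk hpi)[_ [e [b [u' [w' [Ke uu wO' ->]]]]]].
have [a [e' [Ke' ->]]] := cover_rep uu wO'.
exists b, a, (e *m conj_by (swappow r b) e'); split.
  by apply: (conj_group_mul Kgroup) => //; apply: Gamma1_conj.
have us : swappow r b \in unitmx := conj_group_unit G2group (G2_swap b).
rewrite -!mulmxA; congr (_ *m _); rewrite !mulmxA; congr (_ *m _ *m _).
by rewrite /conj_by mulmxKV.
Qed.

Let rep_sep a a' e : K e -> rep a' = e *m rep a -> a = a'.
Proof.
move=> Ke eE.
have [] := rep_congr hk hpi (w a'.2) tr (uU a.1) (uU a'.1) (wO a.2).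
move=> /(_ (ex_intro2 _ _ e Ke eE))[h1 h2] _.
by apply/esym; case: a a' h1 h2 {eE} => [i j] [i' j'] /= /uinj -> /winj ->.
Qed.

Let separated : (2 * t < r)%N -> forall e u1 w1 u2 w2, K e ->
  unitO v u1 -> I 0 w1 -> unitO v u2 -> I 0 w2 ->
  e *m (swapmx r *m (basemx r t *m affmx u1 w1)) =
  basemx r t *m affmx u2 w2 -> False.
Proof.
move=> lt e u1 w1 u2 w2 Ke uu1 wO1 uu2 wO2.
exact: (swap_rep_separated hk hpi Ke uu1 uu2 wO1 wO2 lt).
Qed.

Let separated' : (2 * t < r)%N -> forall e u1 w1 u2 w2, K e ->
  unitO v u1 -> I 0 w1 -> unitO v u2 -> I 0 w2 ->
  e *m (basemx r t *m affmx u1 w1) =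
  swapmx r *m (basemx r t *m affmx u2 w2) -> False.
Proof.
move=> lt e u1 w1 u2 w2 Ke uu1 wO1 uu2 wO2 eE.
have ue := conj_group_unit Kgroup Ke.
apply: (separated lt (conj_group_inv Kgroup Ke) uu2 wO2 uu1 wO1).
by rewrite -eE mulKmx.
Qed.

Let Kswap_cases g : Gamma2 (eichler0 r) g ->
  exists e b, K e /\ g = e *m swappow r b.
Proof. by move=> /(Gamma2_eichler0 hk hpi)[e Ke [b ->]]; exists e, b. Qed.

Let base_affmx1 : basemx r t = basemx r t *m affmx 1 0.
Proof. by rewrite /affmx -mx2_scalar mulmx1. Qed.

Let affine_of_normalizer n : normalizes n -> exists a u' w',
  [/\ a != 0, unitO v u', I 0 w' & n = a *: affmx u' w'].
Proof. by move=> [un nH]; apply: (normalizer_upper_pi hk hpi un nH). Qed.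

Let base_optimal b : P (swappow r b *m basemx r t).
Proof.
apply: G2_optimal; first exact: G2_swap.
exact: optimal_conj_base.
Qed.

Lemma card_embeddings1_gt : (2 * t < r)%N ->
  embedding_orbits E H (Gamma1 E) #= `I_(2 * (#|U| * #|W|)).
Proof.
move=> lt; have -> : (2 * (#|U| * #|W|) = #|((bool * (U * W))%type : finType)|)%N.
  by rewrite !card_prod card_bool.
apply: (card_embedding_orbits hk hpi uh Kgroup image_Gamma1
  (rho := fun ba => swappow r ba.1 *m rep ba.2)).
- by move=> [b a]; apply: G2_optimal; [apply: G2_swap|apply: rep_optimal].
- move=> g /cover_swap[b [a [e [Ke ->]]]]; exists (b, a), e.
  by split.
move=> [b a] [b' a'] e Ke /=; case: b b' => -[] eE.
- have us := swapmx_unit hk hpi r; congr pair.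
  apply: (rep_sep (e := conj_by (invmx (swapmx r)) e)).
    by apply: Gamma1_conj => //; apply: Gamma2_inv; apply: (G2_swap true).
  by rewrite /conj_by invmxK -!mulmxA -eE mulKmx.
- rewrite mul1mx in eE.
  by case: (separated lt Ke (uU a.1) (wO a.2) (uU a'.1) (wO a'.2)).
- rewrite mul1mx in eE.
  by case: (separated' lt Ke (uU a.1) (wO a.2) (uU a'.1) (wO a'.2)).
- rewrite !mul1mx in eE.
  by rewrite (rep_sep Ke eE).
Qed.

(** The swap belongs to the normalizer and exchanges the two families of cosets, so one family
    represents all orbits. *)
Lemma card_embeddings2_gt : (2 * t < r)%N ->
  embedding_orbits E H (Gamma2 E) #= `I_(#|U| * #|W|).
Proof.
move=> lt; rewrite -card_prod.
apply: (card_embedding_orbits hk hpi uh G2group image_Gamma2 (rho := rep)).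
- exact: rep_optimal.
- move=> g /cover_swap[b [a [e [Ke ->]]]]; exists a, (e *m swappow r b).
  rewrite mulmxA; split => //.
  by apply: (conj_group_mul G2group); [apply: K_G2|apply: G2_swap].
move=> a a' g /Kswap_cases[e [[] [Ke ->]]] => [eE|].
  by case: (separated lt Ke (uU a.1) (wO a.2) (uU a'.1) (wO a'.2)); rewrite mulmxA.
by rewrite mulmx1 => /(rep_sep Ke).
Qed.

(** The affine factor normalizes H and is absorbed on the right, which leaves only the exponent of
    the swap. *)
Lemma card_suborders1_gt : (2 * t < r)%N ->
  suborder_orbits v E H (Gamma1 E) #= `I_2.
Proof.
move=> lt; have -> : `I_2 = `I_#|(bool : finType)| by rewrite card_bool.
apply: (card_suborder_orbits hk hpi uh Kgroup image_Gamma1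
  (rho := fun b => swappow r b *m basemx r t)).
- exact: base_optimal.
- move=> g /cover_swap[b [a [e [Ke ->]]]].
  have [un nH] := normalizes_affmx (uU a.1) (wO a.2).
  by exists b, e, (affmx (u a.1) (w a.2)); split => //; rewrite !mulmxA.
have u1 := unitO1 hk; have O0 := val_ideal0 v 0.
move=> b b' e n Ke un nH.
have [c [u' [w' [c0 uu' wO' ->]]]] := affine_of_normalizer (conj un nH).
have Kce : K (c *: e) by apply: (conj_groupZ Kgroup).
rewrite -scalemxAr !scalemxAl => eE.
case: b b' eE => -[] //; rewrite /= !mul1mx => eE.
- case: (separated lt Kce uu' wO' u1 O0).
  by rewrite -base_affmx1 [RHS]eE !mulmxA.
- case: (separated' lt Kce uu' wO' u1 O0).
  by rewrite -base_affmx1 [RHS]eE !mulmxA.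
Qed.

Lemma card_suborders2 : suborder_orbits v E H (Gamma2 E) #= `I_1.
Proof.
have -> : `I_1 = `I_#|(unit : finType)| by rewrite card_unit.
apply: (card_suborder_orbits hk hpi uh G2group image_Gamma2
  (rho := fun=> basemx r t)); last by move=> [] [].
- by move=> _; have := base_optimal false; rewrite mul1mx.
move=> g /cover_swap[b [a [e [Ke ->]]]].
have [un nH] := normalizes_affmx (uU a.1) (wO a.2).
exists tt, (e *m swappow r b), (affmx (u a.1) (w a.2)).
split => //; last by rewrite !mulmxA.
by apply: (conj_group_mul G2group); [apply: K_G2|apply: G2_swap].
Qed.

Let swap_rep : r = (2 * t)%N -> forall u' w',
  swapmx r *m (basemx r t *m affmx u' w') =
  (- pi ^+ t) *: (basemx r t *m affmx (- u') (- w' - 1)).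
Proof.
move=> rt u' w'; rewrite mulmxA {1 2}rt swap_base -rt -scalemxAl -mulmxA affmxM.
by congr (_ *: (_ *m affmx _ _)); ring.
Qed.

Let O1 := integers1 hk.

Let cover_eq : r = (2 * t)%N -> forall g, P g -> exists a e, K e /\ g = e *m rep a.
Proof.
move=> rt g /cover_swap[[] [a [e [Ke ->]]]]; last by exists a, e; rewrite mul1mx.
rewrite /swappow swap_rep // -scalemxAr scalemxAl.
have [||a' [e' [Ke' ->]]] := @cover_rep (- u a.1) (- w a.2 - 1).
- exact: unitON.
- by apply: (val_idealB hk) => //; apply: (val_idealN hk).
exists a', ((- pi ^+ t *: e) *m e'); rewrite !mulmxA; split=> //.
apply: (conj_group_mul Kgroup) => //; apply: (conj_groupZ Kgroup) => //.
by rewrite oppr_eq0 (expu_neq0 hpi).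
Qed.

Lemma card_embeddings1_eq : r = (2 * t)%N ->
  embedding_orbits E H (Gamma1 E) #= `I_(#|U| * #|W|).
Proof.
move=> rt; rewrite -card_prod.
apply: (card_embedding_orbits hk hpi uh Kgroup image_Gamma1 (rho := rep)).
- exact: rep_optimal.
- exact: cover_eq.
- by move=> a a' e; apply: rep_sep.
Qed.

(** For r = 2t the swap sends the double coset of Z to itself, so one class remains. *)
Lemma card_suborders1_eq : r = (2 * t)%N ->
  suborder_orbits v E H (Gamma1 E) #= `I_1.
Proof.
move=> rt; have -> : `I_1 = `I_#|(unit : finType)| by rewrite card_unit.
apply: (card_suborder_orbits hk hpi uh Kgroup image_Gamma1
  (rho := fun=> basemx r t)); last by move=> [] [].
- by move=> _; have := base_optimal false; rewrite mul1mx.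
move=> g /(cover_eq rt)[a [e [Ke ->]]].
have [un nH] := normalizes_affmx (uU a.1) (wO a.2).
by exists tt, e, (affmx (u a.1) (w a.2)); split => //; rewrite !mulmxA.
Qed.

(** Serves t = 0, where the swap fixes the only class, so that the count is 1 and not a half. *)
Lemma card_embeddings2_trivial : r = (2 * t)%N -> (#|U| * #|W| = 1)%N ->
  embedding_orbits E H (Gamma2 E) #= `I_1.
Proof.
move=> rt card1.
have -> : `I_1 = `I_#|((U * W)%type : finType)| by rewrite card_prod card1.
apply: (card_embedding_orbits hk hpi uh G2group image_Gamma2 (rho := rep)).
- exact: rep_optimal.
- by move=> g /(cover_eq rt)[a [e [/K_G2 Ge ->]]]; exists a, e.
by move=> a a' _ _ _; apply: (fintype_le1P _); rewrite card_prod card1.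
Qed.

Lemma card_embeddings2_eq : r = (2 * t)%N -> (0 < t)%N ->
  embedding_orbits E H (Gamma2 E) #= `I_((#|U| * #|W|) %/ 2).
Proof.
move=> rt t0.
(* The action (u, w) -> (-u, -w - 1) of the swap, expressed on the chosen representatives. *)
have iotaP (a : U * W) : exists a' : U * W,
    I t%:Z (u a'.1 + u a.1) /\ I t%:Z (w a'.2 + w a.2 + 1).
  have [i hi] := ucover (unitON hk (uU a.1)).
  have [|j hj] := @wcover (- w a.2 - 1).
    by apply: (val_idealB hk) => //; apply: (val_idealN hk).
  exists (i, j); split=> /=.
    by have := val_idealN hk hi; rewrite opprB opprK.
  have := val_idealN hk hj; congr I; ring.
have [iota iP] := boolp.choice iotaP.
have tW x : I t%:Z x -> I 1 x by apply: val_idealW; lia.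
have eq_iota a a' : I t%:Z (u a'.1 + u a.1) -> I t%:Z (w a'.2 + w a.2 + 1) ->
    a' = iota a.
  move=> h1 h2; have [h3 h4] := iP a.
  case: (iota a) a' h1 h2 h3 h4 => [i j] [i' j'] /= h1 h2 h3 h4.
  congr pair; [apply: uinj|apply: winj].
    by have := val_idealB hk h1 h3; congr I; ring.
  by have := val_idealB hk h2 h4; congr I; ring.
have invo : involutive iota.
  move=> a; apply/esym; have [h1 h2] := iP a.
  by apply: eq_iota; [rewrite addrC|rewrite [X in X + 1]addrC].
(* A fixed point gives 2u = 0 and 2w + 1 = 0 modulo pi^t, hence modulo pi because t > 0. As u is a
   unit, 2 = 0 and then 1 = 0 modulo pi. *)
have free a : iota a != a.
  apply/eqP => aa; have := iP a; rewrite aa => -[/tW h1 /tW h2].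
  have h3 : I 1 2.
    have [u0 _ uV] := unitOP hk (uU a.1).
    have -> : 2 = (u a.1)^-1 * (u a.1 + u a.1) :> k by field.
    exact: (integersMl hk).
  apply: (unitO_val_ideal1 (unitO1 hk)).
  have -> : 1 = (w a.2 + w a.2 + 1) - w a.2 * 2 by ring.
  by apply: (val_idealB hk) => //; apply: (integersMl hk).
have [J [f [cJ fcover fsep]]] := free_involution_reps invo free.
have -> : ((#|U| * #|W|) %/ 2 = #|J|)%N by rewrite -card_prod -cJ mulnK.
have p0 : - pi ^+ t != 0 by rewrite oppr_eq0 (expu_neq0 hpi).
have swap_iota a : exists2 e, K e & rep (iota a) = e *m (swapmx r *m rep a).
  rewrite swap_rep //; set x := basemx r t *m affmx (- u a.1) (- w a.2 - 1).
  have [h1 h2] := iP a.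
  have := rep_congr hk hpi (w (iota a).2) tr (unitON hk (uU a.1)) (uU (iota a).1).
  move=> /(_ (- w a.2 - 1))[]; first by apply: (val_idealB hk) => //; apply: (val_idealN hk).
  move=> _ []; first split.
  - by rewrite opprK.
  - by rewrite opprB [1 + _]addrC opprK addrA.
  move=> e Ke eE; exists ((- pi ^+ t)^-1 *: e).
    by apply: (conj_groupZ Kgroup) => //; rewrite invr_eq0.
  by rewrite -scalemxAl -scalemxAr scalerA mulVf // scale1r.
apply: (card_embedding_orbits hk hpi uh G2group image_Gamma2 (rho := rep \o f)).
- by move=> j; apply: rep_optimal.
- move=> g /(cover_eq rt)[a [e [Ke ->]]]; have [j [->|->]] := fcover a.
    by exists j, e; split=> //; apply: K_G2.
  have [e' Ke' ->] := swap_iota (f j).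
  exists j, (e *m e' *m swapmx r); rewrite !mulmxA; split=> //.
  apply: (conj_group_mul G2group); last exact: (G2_swap true).
  by apply: K_G2; apply: (conj_group_mul Kgroup).
move=> i j g /Kswap_cases[e [b [Ke ->]]] /= eE; apply/esym/fsep.
case: b eE => eE; last first.
  by left; rewrite mulmx1 in eE; rewrite (rep_sep Ke eE).
right; have [e' Ke' iE] := swap_iota (f i).
apply/esym; apply: (rep_sep (e := e *m invmx e')); last first.
  rewrite eE iE -!mulmxA mulKmx //; exact: (conj_group_unit Kgroup).
by apply: (conj_group_mul Kgroup) => //; apply: (conj_group_inv Kgroup).
Qed.

End Counting.

Theorem theorem1p3 (k : fieldType) (v : k -> int) (pi : k) (p r t : nat)
    (E : set 'M[k]_2)
    (hk : local_field v) (hpi : uniformizer v pi)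
    (hp : residue_field v #= `I_p)
    (hE : eichler_order v pi r E) :
  let H := order_level v pi t (upper_order v) in
  [/\ optimal_embeddings E H !=set0 <-> (2 * t <= r)%N,
      (0 < t)%N -> r = (2 * t)%N ->
        embedding_numbers v E H
          ((p - 1) * p ^ (2 * t - 1), ((p - 1) * p ^ (2 * t - 1)) %/ 2, 1, 1)%N,
      (0 < t)%N -> (2 * t < r)%N ->
        embedding_numbers v E H
          (2 * ((p - 1) * p ^ (2 * t - 1)), (p - 1) * p ^ (2 * t - 1), 2, 1)%N,
      t = 0%N -> r = 0%N -> embedding_numbers v E H (1, 1, 1, 1)%N &
      t = 0%N -> (0 < r)%N -> embedding_numbers v E H (2, 1, 2, 1)%N].
Proof.
move=> H; have [h uh ->] := eichler_order_conj hk hpi hE.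
have [W [w [cW wO wcover winj]]] := integers_mod_reps hk hpi hp t.
have [U [u [cU uU ucover uinj]]] := units_mod_reps hk hpi hp t.
(* The exponents t - 1, from the units, and t, from the residues, add up to 2t - 1. *)
have cpos : (0 < t)%N -> (#|U| * #|W| = (p - 1) * p ^ (2 * t - 1))%N.
  rewrite cU cW; case: (t) => // s _.
  by rewrite -mulnA -expnD; congr (_ * p ^ _)%N; lia.
have c0 : t = 0%N -> (#|U| * #|W| = 1)%N by rewrite cU cW => ->.
have gt_case : (2 * t < r)%N -> embedding_numbers v (conj_by h @` eichler0 v r) H
    (2 * (#|U| * #|W|), #|U| * #|W|, 2, 1)%N.
  move=> lt; split.
  - exact: (card_embeddings1_gt hk hpi (ltnW lt) uh uU ucover uinj wO wcover winj lt).
  - exact: (card_embeddings2_gt hk hpi (ltnW lt) uh uU ucover uinj wO wcover winj lt).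
  - exact: (card_suborders1_gt hk hpi (ltnW lt) uh uU ucover wO wcover lt).
  - exact: (card_suborders2 hk hpi (ltnW lt) uh uU ucover wO wcover).
have eq_case e2 : r = (2 * t)%N ->
    embedding_orbits (conj_by h @` eichler0 v r) H
      (Gamma2 (conj_by h @` eichler0 v r)) #= `I_e2 ->
    embedding_numbers v (conj_by h @` eichler0 v r) H
      (#|U| * #|W|, e2, 1, 1)%N.
  move=> rt he2; have tr : (2 * t <= r)%N by rewrite rt.
  split=> //.
  - exact: (card_embeddings1_eq hk hpi tr uh uU ucover uinj wO wcover winj rt).
  - exact: (card_suborders1_eq hk hpi tr uh uU ucover wO wcover rt).
  - exact: (card_suborders2 hk hpi tr uh uU ucover wO wcover).
split.
- split=> [[f]|tr].
    move=> /(optimal_embeddingsP hk hpi)[g gP _].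
    have : optimal_conj (eichler0 v r) H (invmx h *m g).
      by apply/(optimal_conj_image _ _ _ uh); rewrite mulKVmx.
    by move=> /(optimal_conj_classify hk hpi)[].
  (* Conjugation by Z is optimal into E_r, and h transports it to E. *)
  exists (fun x => conj_by (h *m basemx pi r t) (val x)).
  apply/(optimal_embeddingsP hk hpi); exists (h *m basemx pi r t) => //.
  by apply/optimal_conj_image => //; apply: optimal_conj_base.
- move=> t0 rt; rewrite -cpos //; apply: eq_case => //.
  have tr : (2 * t <= r)%N by rewrite rt.
  exact: (card_embeddings2_eq hk hpi tr uh uU ucover uinj wO wcover winj rt t0).
- by move=> t0 lt; rewrite -cpos //; apply: gt_case.
- move=> t0 r0; have rt : r = (2 * t)%N by rewrite t0.
  have tr : (2 * t <= r)%N by rewrite rt.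
  have := @eq_case 1%N rt; rewrite c0 //; apply.
  exact: (card_embeddings2_trivial hk hpi tr uh uU ucover wO wcover rt (c0 t0)).
- move=> t0 r0; have := gt_case; rewrite c0 // muln1; apply.
  by rewrite t0.
Qed.
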